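(* Let $k \le \min\{m,n\}$ be positive integers and let $$G_{\mathcal{M}}: \mathbb{R}^{m\times k}_k \times \mathbb{R}^{k\times n}_k \to \mathbb{R}^{m\times n}, \qquad (L,R) \mapsto LR,$$ where $\mathbb{R}^{m\times k}_k$ and $\mathbb{R}^{k\times n}_k$ are the sets of matrices of rank $k$ in $\mathbb{R}^{m \times k}$ and $\mathbb{R}^{k \times n}$. Let $\sigma_i(\cdot)$ denote the $i$th largest singular value of its argument if $i \le k$ and $\sigma_i(\cdot) := 0$ if $i > k$. At every point $(L,R)$ of the domain, we have $$\kappa_{\star}^{inv}[G_{\mathcal{M}}](L,R) = \frac{1}{\sqrt{\min\left\{ \sigma_k(L)^2 + \sigma_n(R)^2,\; \sigma_m(L)^2 + \sigma_k(R)^2 \right\}}}$$ with respect to the Euclidean inner products on $\mathbb{R}^{m\times n}$ and $\mathbb{R}^{m\times k}\times\mathbb{R}^{k\times n}$. If $k < \min\{m,n\}$, then $\kappa_{\star}^{inv}[G_{\mathcal{M}}](L,R) = \min\{\sigma_k(L), \sigma_k(R)\}^{-1}$.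
   Context: Feasible constant-rank equation (FCRE). For smooth manifolds $\mathcal{X},\mathcal{Y},\mathcal{Z}$, a constant $c\in\mathcal{Z}$ and a smooth map $F:\mathcal{X}\times\mathcal{Y}\to\mathcal{Z}$, the equation $F(x,y)=c$ is an FCRE if (1) for all $x\in\mathcal{X}$ there exists $y\in\mathcal{Y}$ with $F(x,y)=c$; and (2) there exists $r\in\mathbb{N}$ such that $\operatorname{rank}\frac{\partial}{\partial y}F(x,y)=\operatorname{rank}DF(x,y)=r$ for all $(x,y)$. Latent condition number. If $F(x,y)=c$ is an FCRE, $\mathcal{X},\mathcal{Y}$ are Riemannian, and $F(x_0,y_0)=c$, then for $x$ near $x_0$ the map $H_{y_0}(x):=\arg\min\{d_{\mathcal{Y}}(y_0,y): y\in\mathcal{Y},\ F(x,y)=c\}$ is well defined and smooth ($d_{\mathcal{Y}}$ the geodesic distance), and $$\kappa_\star[F^{-1}(c)](x_0,y_0):=\limsup_{x\to x_0}\frac{d_{\mathcal{Y}}(H_{y_0}(x_0),H_{y_0}(x))}{d_{\mathcal{X}}(x,x_0)}=\left\|\left(\frac{\partial}{\partial y}F(x_0,y_0)\right)^\dagger\frac{\partial}{\partial x}F(x_0,y_0)\right\|,$$ with $\|\cdot\|$ the operator norm and $\cdot^\dagger$ the Moore--Penrose inverse. Inverse problems. Let $\mathcal{Y}$ be a Riemannian manifold and $G:\mathcal{Y}\to\mathbb{R}^N$ a smooth map with $\operatorname{rank}DG(y)$ constant. Every $y_0\in\mathcal{Y}$ has a neighbourhood $\widehat{\mathcal{Y}}$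 such that $\mathcal{X}:=G(\widehat{\mathcal{Y}})$ is an embedded submanifold of $\mathbb{R}^N$ (given the induced metric) and, with $F:\mathcal{X}\times\widehat{\mathcal{Y}}\to\mathbb{R}^N$, $F(x,y):=G(y)-x$, the equation $F(x,y)=0$ is an FCRE. One sets $\kappa_\star^{inv}[G](y_0):=\kappa_\star[F^{-1}(0)](G(y_0),y_0)$, which equals $\|DG(y_0)^\dagger\|$. Here the map $G_{\mathcal{M}}$, with $\mathbb{R}^{m\times n}$ identified with $\mathbb{R}^{mn}$, has constant-rank differential, so the definition applies.
   Formalization: In the definition of FCRE, rank DF(x,y) = r is required only where F(x,y) = c (rank of the y-derivative is still r for all (x,y)), since for F(x,y) = G(y) − x the literal condition fails off the solution set, e.g. k=1, m=n=2. *)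

(* Defs.v *)
From HB Require Import structures.
From mathcomp Require Import all_boot all_order all_algebra.
From mathcomp Require Import all_classical all_reals all_analysis.

Set Implicit Arguments.
Unset Strict Implicit.
Unset Printing Implicit Defensive.

Import Order.TTheory GRing.Theory Num.Theory numFieldNormedType.Exports.
Local Open Scope classical_set_scope.
Local Open Scope ring_scope.

Section Smooth.
Context {R : realType} {V W : normedModType R}.

(* For finite-dimensional V this is the usual class C^p on an open set U. *)
Fixpoint Cp_on (p : nat) (U : set V) (f : V -> W) : Prop :=
  if p is q.+1 then
    (forall x, U x -> differentiable f x) /\
    (forall v, Cp_on q U (fun x => 'D_v f x))
  else forall x, U x -> {for x, continuous f}.

Definition smooth_on (U : set V) (f : V -> W) : Prop :=
  forall p, Cp_on p U f.

End Smooth.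

Definition is_subspace_of_dim {R : realType} {V : normedModType R}
    (r : nat) (T : set V) : Prop :=
  exists b : 'I_r -> V,
    (forall c : 'I_r -> R, \sum_i c i *: b i = 0 -> forall i, c i = 0) /\
    T = [set \sum_i c i *: b i | c in [set: 'I_r -> R]].

(* Manifolds are embedded submanifolds of a finite-dimensional space V, with the
   Riemannian metric induced by an inner product dot : V -> V -> R. *)
Section Submanifold.
Context {R : realType} {V : normedModType R}.

(* Slice charts: phi is a diffeomorphism from U onto an open subset of V, with
   inverse psi, flattening X to an r-dimensional linear subspace of V. *)
Definition embedded_submanifold (X : set V) : Prop :=
  exists r : nat, forall x, X x ->
    exists (U T : set V) (phi psi : V -> V),
      [/\ open U, U x & open (phi @` U)] /\
      [/\ smooth_on U phi, smooth_on (phi @` U) psi,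
          (forall u, U u -> psi (phi u) = u),
          is_subspace_of_dim r T &
          phi @` (U `&` X) = (phi @` U) `&` T].

Definition tangent_space (X : set V) (x : V) : set V :=
  [set v | exists g : R -> V,
     [/\ g 0 = x, (\forall t \near (0 : R), X (g t)) & is_derive (0 : R) 1 g v]].

Definition enorm (dot : V -> V -> R) (v : V) : R := Num.sqrt (dot v v).

Definition curve_in (X : set V) (p q : V) (g : R -> V) : Prop :=
  [/\ (forall t, derivable g t 1), continuous (derive1 g),
      (forall t, t \in `[0, 1] -> X (g t)), g 0 = p & g 1 = q].

Definition curve_length (dot : V -> V -> R) (g : R -> V) : \bar R :=
  (\int[lebesgue_measure]_(t in `[0%R, 1%R]) (enorm dot (derive1 g t))%:E)%E.

(* Riemannian distance of X, +oo between distinct path components.  Curves need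
   not be regular, so a piecewise C^1 curve can be reparametrised, stopping at
   its corners, into a C^1 curve of the same length: the infimum is the one
   over piecewise C^1 curves. *)
Definition geodist (dot : V -> V -> R) (X : set V) (p q : V) : \bar R :=
  ereal_inf [set curve_length dot g | g in curve_in X p q].

End Submanifold.

Section LatentCondition.
Context {R : realType} {V1 V2 W : normedModType R}.

(* F is given on the ambient spaces and smooth near X x Y.  The rank of the
   differential of F is required to be r at the solutions of the equation only:
   for F (x, y) = G y - x on the image X of G, which is the use made of the
   notion below, it exceeds r off the solution set unless X is flat. *)
Record fcre (X : set V1) (Y : set V2) (F : V1 * V2 -> W) (c : W) : Prop := Fcre {
  fcre_X : embedded_submanifold X;
  fcre_Y : embedded_submanifold Y;
  fcre_smooth : exists O : set (V1 * V2),
    [/\ open O, X `*` Y `<=` O & smooth_on O F];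
  fcre_feasible : forall x, X x -> exists2 y, Y y & F (x, y) = c;
  fcre_rank : exists r : nat, forall x y, X x -> Y y ->
    is_subspace_of_dim r
      [set 'd (fun y' => F (x, y')) y w | w in tangent_space Y y] /\
    (F (x, y) = c ->
     is_subspace_of_dim r
       [set 'd F (x, y) w | w in tangent_space X x `*` tangent_space Y y])
}.

Definition nearest_solutions (dotY : V2 -> V2 -> R) (Y : set V2)
    (F : V1 * V2 -> W) (c : W) (y0 : V2) (x : V1) : set V2 :=
  [set y | [/\ Y y, F (x, y) = c &
     forall y', Y y' -> F (x, y') = c ->
       (geodist dotY Y y0 y <= geodist dotY Y y0 y')%E]].

(* The argmin map; its default value y0 is irrelevant, as a minimiser exists
   for x close to x0. *)
Definition nearest_solution dotY Y F c y0 (x : V1) : V2 :=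
  xget y0 (nearest_solutions dotY Y F c y0 x).

Definition latent_cond (dotX : V1 -> V1 -> R) (dotY : V2 -> V2 -> R)
    (X : set V1) (Y : set V2) (F : V1 * V2 -> W) (c : W)
    (x0 : V1) (y0 : V2) : \bar R :=
  let H := nearest_solution dotY Y F c y0 in
  limf_esup (fun x => geodist dotY Y (H x0) (H x) / geodist dotX X x x0)%E
    (within X x0^').

End LatentCondition.

Section InverseProblem.
Context {R : realType} {V W : normedModType R}.

Definition inverse_eq (G : V -> W) (p : W * V) : W := G p.2 - p.1.

Definition admissible_nbhd (D : set V) (G : V -> W) (y0 : V) (Y : set V) : Prop :=
  [/\ open Y, Y y0, Y `<=` D, embedded_submanifold (G @` Y) &
      fcre (G @` Y) Y (inverse_eq G) 0].

(* The common value of latent_cond over all admissible neighbourhoods of y0.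
   The default -oo can only occur if there is no admissible neighbourhood or if
   the value depends on the neighbourhood: since condition numbers are
   nonnegative, an equation  inv_latent_cond _ _ _ _ _ = r%:E  includes the
   assertion that the condition number is well defined. *)
Definition inv_latent_cond (dotV : V -> V -> R) (dotW : W -> W -> R)
    (D : set V) (G : V -> W) (y0 : V) : \bar R :=
  xget -oo%E [set kappa : \bar R |
    (exists Y, admissible_nbhd D G y0 Y) /\
    (forall Y, admissible_nbhd D G y0 Y ->
       latent_cond dotW dotV (G @` Y) Y (inverse_eq G) 0 (G y0) y0 = kappa)].

End InverseProblem.

Section Matrices.
Context {R : realType}.

Definition mxdot {m n : nat} (A B : 'M[R]_(m, n)) : R := \tr (A *m B^T).

Definition mxdot2 {m n p q : nat} (A B : 'M[R]_(m, n) * 'M[R]_(p, q)) : R :=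
  mxdot A.1 B.1 + mxdot A.2 B.2.

Definition is_singular_values {m n : nat} (A : 'M[R]_(m, n)) (s : seq R) : Prop :=
  [/\ size s = minn m n, sorted >=%R s, all (fun x => 0 <= x) s &
      exists (U : 'M[R]_m) (V : 'M[R]_n),
        [/\ U *m U^T = 1%:M, V *m V^T = 1%:M &
            A = U *m (\matrix_(i, j) if i == j :> nat then s`_i else 0) *m V^T]].

(* sigma i A is the i-th largest singular value (i >= 1), with value 0 for
   i > minn m n. *)
Definition sigma (i : nat) {m n : nat} (A : 'M[R]_(m, n)) : R :=
  (xget [::] (is_singular_values A))`_i.-1.

(* The domain is an open subset of the ambient product space. *)
Definition full_rank_pairs (m n k : nat) :
    set ('M[R]_(m, k) * 'M[R]_(k, n))%type :=
  [set p | \rank p.1 = k /\ \rank p.2 = k].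

Definition GM (m n k : nat) (p : 'M[R]_(m, k) * 'M[R]_(k, n)) : 'M[R]_(m, n) :=
  p.1 *m p.2.

End Matrices.

Arguments full_rank_pairs R m n k : clear implicits.
Arguments GM R m n k p : clear implicits.

(* Main.v *)
Require Import Defs.
From HB Require Import structures.
From mathcomp Require Import all_boot all_order all_algebra.
From mathcomp Require Import all_classical all_reals all_analysis.
From mathcomp Require Import ring lra.
Import Order.TTheory GRing.Theory Num.Theory numFieldNormedType.Exports.
Local Open Scope classical_set_scope.
Local Open Scope ring_scope.
Set Implicit Arguments.
Unset Strict Implicit.
Unset Printing Implicit Defensive.

(** Fix y0 = (L, R), put x0 = L R, and write DG(A, B) = A R + L B for the
    differential of the product map at y0 and N(A, B) = L^T A - B R^T.  Norms
    are Frobenius norms and s denotes the square root of the minimum in the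
    formula.

    Algebra.  The cross terms cancel in
      |DG w|^2 + |N w|^2 = |L^T A|^2 + |A R|^2 + |L B|^2 + |B R^T|^2
    for w = (A, B) ([dGM_imbalance]), and bounding each term on the right by a
    smallest singular value gives s^2 |w|^2 <= |DG w|^2 + |N w|^2
    ([singular_gap_le]).  The fibre through y = (L', R') is the orbit of the
    pairs (L' C, C^-1 R') with C invertible, so N, taken at y, vanishes on w
    exactly if w is orthogonal to the fibre at y.

    Upper bound.  If y is a point of its fibre nearest to y0 and w = y - y0,
    then N, taken at y, vanishes on w ([balanced_of_local_min]).  Hence N at y0
    is quadratic in w, as is the difference between DG w and G y - x0, and
      s |w| <= |G y - x0| + 2 |w|^2  ([balanced_lower_bound]).
    Geodesic distances dominate Euclidean ones ([enorm_sub_le_geodist]), and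
    the nearest point tends to y0 as its image tends to x0, because a skeleton
    decomposition gives a continuous local section of G ([GM_local_section]).
    So the limit superior is at most 1 / s.

    Lower bound.  Let M = u v^T with u a left singular vector of L and v a right
    singular vector of R that realise the minimum, and let w = (M R^T, L^T M)
    be the image of M under the adjoint of DG.  Then |M| = 1, |w| = s,
    DG w = s^2 M and <M, DG w'> = <w, w'> ([exists_extremal_direction]).  Along
    x_t = G (y0 + t w) the pairing with M shows that every solution near y0 is
    at distance at least t s - O(t^2) from y0 ([fibre_distance_ge]), while
    the curve x_t itself shows that the geodesic distance from x_t to x0 is at
    most t s^2 + O(t^2) ([distX_direction_le]).  Nearest solutions exist here by
    compactness ([exists_nearest_solution]), so 1 / s is approached.

    These estimates hold in every admissible neighbourhood.  That there is
    one is the last ingredient: the whole domain is admissible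
    ([admissible_full_rank_pairs]), because in the coordinates of a skeleton
    decomposition the matrices of rank k are the zero set of a Schur complement.
    Singular value decompositions are constructed by maximising a bilinear form
    over unit vectors ([exists_singular_values]). *)

(** * Inner products *)

(** Domination of the ambient norm and continuity together say that the inner
    product norm defines the ambient topology. *)
Record inner_product {R : realType} {V : normedModType R} (dot : V -> V -> R) :
    Prop := InnerProduct {
  dotC : forall x y, dot x y = dot y x;
  dotDl : forall x y z, dot (x + y) z = dot x z + dot y z;
  dotZl : forall a x y, dot (a *: x) y = a * dot x y;
  norm_le_enorm : forall x, `|x| <= enorm dot x;
  dot_ge0 : forall x, 0 <= dot x x;
  dot_continuous : continuous (fun p : V * V => dot p.1 p.2)
}.

Section InnerProduct.
Context {R : realType} {V : normedModType R} {dot : V -> V -> R}.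
Hypothesis ip : inner_product dot.

Lemma dotDr x y z : dot x (y + z) = dot x y + dot x z.
Proof. by rewrite !(dotC ip x) (dotDl ip). Qed.

Lemma dotZr a x y : dot x (a *: y) = a * dot x y.
Proof. by rewrite !(dotC ip x) (dotZl ip). Qed.

Lemma dotNl x y : dot (- x) y = - dot x y.
Proof. by rewrite -scaleN1r (dotZl ip) mulN1r. Qed.

Lemma dotNr x y : dot x (- y) = - dot x y.
Proof. by rewrite !(dotC ip x) dotNl. Qed.

Lemma dotBl x y z : dot (x - y) z = dot x z - dot y z.
Proof. by rewrite (dotDl ip) dotNl. Qed.

Lemma dotBr x y z : dot x (y - z) = dot x y - dot x z.
Proof. by rewrite dotDr dotNr. Qed.

Lemma dot0l x : dot 0 x = 0.
Proof. by rewrite -(scale0r (0 : V)) (dotZl ip) mul0r. Qed.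

Lemma enorm_ge0 x : 0 <= enorm dot x. Proof. exact: sqrtr_ge0. Qed.

Lemma sqr_enorm x : enorm dot x ^+ 2 = dot x x.
Proof. by rewrite sqr_sqrtr ?(dot_ge0 ip). Qed.

Lemma enormZ a x : enorm dot (a *: x) = `|a| * enorm dot x.
Proof.
by rewrite /enorm (dotZl ip) dotZr mulrA -expr2 sqrtrM ?sqr_ge0// sqrtr_sqr.
Qed.

Lemma enormN x : enorm dot (- x) = enorm dot x.
Proof. by rewrite -scaleN1r enormZ normrN1 mul1r. Qed.

Lemma enorm0 : enorm dot 0 = 0.
Proof. by rewrite /enorm dot0l sqrtr0. Qed.

Lemma enorm_eq0 x : enorm dot x = 0 -> x = 0.
Proof.
by move=> x0; apply/eqP; rewrite -normr_le0 -x0; exact: norm_le_enorm.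
Qed.

Lemma dot_le_enorm x y : dot x y <= enorm dot x * enorm dot y.
Proof.
have [/enorm_eq0 ->|x0] := eqVneq (enorm dot x) 0.
  by rewrite dot0l enorm0 mul0r.
have [/enorm_eq0 ->|y0] := eqVneq (enorm dot y) 0.
  by rewrite (dotC ip) dot0l enorm0 mulr0.
have xp : 0 < enorm dot x by rewrite lt0r x0 enorm_ge0.
have yp : 0 < enorm dot y by rewrite lt0r y0 enorm_ge0.
set a := enorm dot x; set b := enorm dot y.
(* Cauchy-Schwarz in the form 0 <= | |y| x - |x| y |^2. *)
have := dot_ge0 ip (b *: x - a *: y).
rewrite dotBl !dotBr !(dotZl ip) !dotZr (dotC ip y x) -!sqr_enorm -/a -/b => h.
have {}h : 0 <= (a * b) * (2 * (a * b - dot x y)).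
  by apply: le_trans h _; rewrite le_eqVlt; apply/orP; left; apply/eqP; ring.
by rewrite pmulr_rge0 ?mulr_gt0// pmulr_rge0// subr_ge0 in h.
Qed.

Lemma enormD x y : enorm dot (x + y) <= enorm dot x + enorm dot y.
Proof.
rewrite -(@ler_pXn2r _ 2) ?nnegrE ?addr_ge0 ?enorm_ge0//.
rewrite sqr_enorm (dotDl ip) !dotDr (dotC ip y x) sqrrD !sqr_enorm.
by have := dot_le_enorm x y; lra.
Qed.

Lemma enormB x y : enorm dot (x - y) <= enorm dot x + enorm dot y.
Proof. by rewrite -(enormN y); exact: enormD. Qed.

Lemma enormBC x y : enorm dot (x - y) = enorm dot (y - x).
Proof. by rewrite -enormN opprB. Qed.

Lemma cvg_dot {T} {F : set_system T} {FF : Filter F} (f g : T -> V) a b :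
  f @ F --> a -> g @ F --> b -> dot (f x) (g x) @[x --> F] --> dot a b.
Proof.
move=> fa gb; apply: (cvg_comp (fun x => (f x, g x)) (fun p => dot p.1 p.2)).
  exact: (cvg_pair fa gb).
exact: (dot_continuous ip (x := (a, b))).
Qed.

Lemma cvg_enorm {T} {F : set_system T} {FF : Filter F} (f : T -> V) a :
  f @ F --> a -> enorm dot (f x) @[x --> F] --> enorm dot a.
Proof.
move=> fa; apply: (cvg_comp (fun x => dot (f x) (f x)) Num.sqrt).
  exact: (cvg_dot fa fa).
exact: sqrt_continuous.
Qed.

Lemma nbhs_enorm_lt (x : V) e : 0 < e -> \forall y \near x, enorm dot (y - x) < e.
Proof.
move=> e0; have : enorm dot (y - x) @[y --> x] --> enorm dot (x - x).
  by apply: cvg_enorm; apply: cvgB => //; exact: cvg_cst.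
rewrite subrr enorm0 => /cvgr_lt; exact.
Qed.

Lemma enorm_nbhs (x : V) (A : set V) : nbhs x A ->
  exists2 e, 0 < e & forall y, enorm dot (y - x) < e -> A y.
Proof.
move=> /nbhs_ballP[e /= e0 eA]; exists e => // y yx; apply: eA.
rewrite -ball_normE/= -normrN opprB.
by apply: le_lt_trans yx; exact: norm_le_enorm.
Qed.

End InnerProduct.

(** * The Frobenius inner product *)

Section Frobenius.
Context {R : realType}.
Implicit Types m n p : nat.

Lemma mxdotE m n (A B : 'M[R]_(m, n)) : mxdot A B = \sum_i \sum_j A i j * B i j.
Proof.
rewrite /mxdot /mxtrace; apply: eq_bigr => i _; rewrite mxE.
by apply: eq_bigr => j _; rewrite mxE.
Qed.

Lemma mxdotDl m n (A B C : 'M[R]_(m, n)) :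
  mxdot (A + B) C = mxdot A C + mxdot B C.
Proof. by rewrite /mxdot mulmxDl mxtraceD. Qed.

Lemma mxdotZl m n a (A B : 'M[R]_(m, n)) : mxdot (a *: A) B = a * mxdot A B.
Proof. by rewrite /mxdot -scalemxAl mxtraceZ. Qed.

Lemma mxdotC m n (A B : 'M[R]_(m, n)) : mxdot A B = mxdot B A.
Proof. by rewrite /mxdot -mxtrace_tr trmx_mul trmxK. Qed.

Lemma mxdot_trmx m n (A B : 'M[R]_(m, n)) : mxdot A^T B^T = mxdot A B.
Proof. by rewrite mxdotC /mxdot trmxK mxtrace_mulC. Qed.

Lemma mxdot_mull m n p (A : 'M[R]_(m, n)) (B : 'M[R]_(n, p)) C :
  mxdot (A *m B) C = mxdot B (A^T *m C).
Proof. by rewrite /mxdot -mulmxA mxtrace_mulC trmx_mul trmxK mulmxA. Qed.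

Lemma mxdot_mulr m n p (A : 'M[R]_(m, n)) (B : 'M[R]_(n, p)) C :
  mxdot (A *m B) C = mxdot A (C *m B^T).
Proof. by rewrite /mxdot trmx_mul trmxK mulmxA. Qed.

Lemma mxdot_ge0 m n (A : 'M[R]_(m, n)) : 0 <= mxdot A A.
Proof.
by rewrite mxdotE sumr_ge0// => i _; rewrite sumr_ge0// => j _; rewrite -expr2 sqr_ge0.
Qed.

Lemma entry_le_mxdot m n (A : 'M[R]_(m, n)) i j : A i j ^+ 2 <= mxdot A A.
Proof.
rewrite mxdotE (bigD1 i)//= (bigD1 j)//= -expr2 -addrA lerDl addr_ge0//.
  by rewrite sumr_ge0// => l _; rewrite -expr2 sqr_ge0.
by rewrite sumr_ge0// => l _; rewrite sumr_ge0// => l' _; rewrite -expr2 sqr_ge0.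
Qed.

Lemma mxdot_continuous m n :
  continuous (fun p : 'M[R]_(m, n) * 'M[R]_(m, n) => mxdot p.1 p.2).
Proof.
move=> p; under eq_fun do rewrite mxdotE.
apply: cvg_big => [|i _]; first exact: add_continuous.
apply: cvg_big => [|j _]; first exact: add_continuous.
apply: cvgM.
  by apply: (cvg_comp fst (fun M : 'M[R]_(m, n) => M i j));
    [exact: cvg_fst|exact: coord_continuous].
by apply: (cvg_comp snd (fun M : 'M[R]_(m, n) => M i j));
    [exact: cvg_snd|exact: coord_continuous].
Qed.

Lemma inner_product_mxdot m n : inner_product (@mxdot R m n).
Proof.
split; [exact: mxdotC|exact: mxdotDl|exact: mxdotZl|
  |exact: mxdot_ge0|exact: mxdot_continuous].
move=> A; rewrite [leLHS]/Num.Def.normr/= mx_normrE.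
rewrite bigmax_le ?enorm_ge0// => -[i j] _ /=.
by rewrite -sqrtr_sqr ler_sqrt ?mxdot_ge0// entry_le_mxdot.
Qed.

Lemma inner_product_mxdot2 m n p q : inner_product (@mxdot2 R m n p q).
Proof.
have d1 := inner_product_mxdot m n; have d2 := inner_product_mxdot p q.
rewrite /mxdot2; split => [x y|x y z|a x y|x|x|].
- by rewrite mxdotC (mxdotC x.2).
- by rewrite /= !mxdotDl addrACA.
- by rewrite /= !mxdotZl mulrDr.
- rewrite [leLHS]/Num.Def.normr/= ge_max; apply/andP; split.
    apply: le_trans (norm_le_enorm d1 x.1) _.
    by rewrite ler_sqrt ?addr_ge0 ?mxdot_ge0// lerDl mxdot_ge0.
  apply: le_trans (norm_le_enorm d2 x.2) _.
  by rewrite ler_sqrt ?addr_ge0 ?mxdot_ge0// lerDr mxdot_ge0.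
- by rewrite addr_ge0 ?mxdot_ge0.
- move=> x; apply: cvgD; apply: cvg_dot => //.
  + by apply: (cvg_comp fst fst); exact: cvg_fst.
  + by apply: (cvg_comp snd fst); [exact: cvg_snd|exact: cvg_fst].
  + by apply: (cvg_comp fst snd); [exact: cvg_fst|exact: cvg_snd].
  + by apply: (cvg_comp snd snd); exact: cvg_snd.
Qed.

Local Notation "`| A |_F" := (enorm mxdot A) (at level 0, A at level 99).

(** Each entry of the product is an inner product of a row with a column. *)
Lemma mxdot_mulmx_le m n p (A : 'M[R]_(m, n)) (B : 'M[R]_(n, p)) :
  mxdot (A *m B) (A *m B) <= mxdot A A * mxdot B B.
Proof.
rewrite [in leRHS]mxdotE (eq_bigr (fun i => mxdot (row i A) (row i A))); last first.
  move=> i _; rewrite mxdotE big_ord1; apply: eq_bigr => j _; by rewrite !mxE.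
rewrite -[X in _ * X]mxdot_trmx [X in _ * X]mxdotE.
rewrite [X in _ * X](eq_bigr (fun i => mxdot (col i B)^T (col i B)^T)); last first.
  move=> i _; rewrite mxdotE big_ord1; apply: eq_bigr => j _; by rewrite !mxE.
rewrite mxdotE mulr_suml; apply: ler_sum => i _; rewrite mulr_sumr.
apply: ler_sum => j _.
have -> : (A *m B) i j = mxdot (row i A) (col j B)^T.
  by rewrite mxdotE big_ord1 mxE; apply: eq_bigr => l _; rewrite !mxE.
have ip := inner_product_mxdot 1 n.
set x := row i A; set y := (col j B)^T.
rewrite -!(sqr_enorm ip) -expr2 -exprMn -ler_sqrt ?sqr_ge0// !sqrtr_sqr.
rewrite [leRHS]ger0_norm ?mulr_ge0 ?enorm_ge0// ler_norml dot_le_enorm// andbT.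
by rewrite lerNl -(dotNl ip) (le_trans (dot_le_enorm ip _ _))// (enormN ip).
Qed.

Lemma enorm_mulmx m n p (A : 'M[R]_(m, n)) (B : 'M[R]_(n, p)) :
  `|A *m B|_F <= `|A|_F * `|B|_F.
Proof.
by rewrite -sqrtrM ?mxdot_ge0// ler_sqrt ?mulr_ge0 ?mxdot_ge0// mxdot_mulmx_le.
Qed.

End Frobenius.

(** * Compactness *)

Section Compactness.
Context {R : realType}.

Lemma cvg_mx {T} {F : set_system T} {FF : Filter F} m n
    (f : T -> 'M[R]_(m, n)) (M : 'M[R]_(m, n)) :
  (forall i j, f x i j @[x --> F] --> M i j) -> f @ F --> M.
Proof.
move=> fM; apply/cvgrPdist_le => /= e e0; near=> x.
rewrite [leLHS]/Num.Def.normr/= mx_normrE (bigmax_le _ (ltW e0))//= => i _.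
rewrite !mxE/=; move: i; near: x; apply: filter_forall => /= i.
exact: ((cvgrPdist_le _ _).1 (fM i.1 i.2)).
Unshelve. all: by end_near. Qed.

Lemma cvg_entry {T} {F : set_system T} {FF : Filter F} m n
    (f : T -> 'M[R]_(m, n)) (M : 'M[R]_(m, n)) i j :
  f @ F --> M -> f x i j @[x --> F] --> M i j.
Proof.
move=> fM; apply: (cvg_comp f (fun N : 'M[R]_(m, n) => N i j) fM).
exact: coord_continuous.
Qed.

Lemma cvg_mulmx {T} {F : set_system T} {FF : Filter F} m n p
    (f : T -> 'M[R]_(m, n)) (g : T -> 'M[R]_(n, p))
    (A : 'M[R]_(m, n)) (B : 'M[R]_(n, p)) :
  f @ F --> A -> g @ F --> B -> f x *m g x @[x --> F] --> A *m B.
Proof.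
move=> fA gB; apply: cvg_mx => i j; rewrite mxE.
under eq_fun do rewrite mxE.
apply: cvg_big => [|l _]; first exact: add_continuous.
by apply: cvgM; exact: cvg_entry.
Qed.

(** Heine-Borel, transported from row vectors along the linear bijection that
    lists the entries of the two matrices. *)
Lemma compact_mx_pair m n p q (A : set ('M[R]_(m, n) * 'M[R]_(p, q))) r :
  (forall x, A x -> `|x| <= r) -> closed A -> compact A.
Proof.
move=> Ar cA.
pose h (v : 'rV[R]_(m * n + p * q)) : 'M[R]_(m, n) * 'M[R]_(p, q) :=
  (vec_mx (lsubmx v), vec_mx (rsubmx v)).
have hc : continuous h.
  have h1 : continuous (fun v => (h v).1).
    move=> v; apply: (cvg_mx (F := nbhs v)) => i j; rewrite !mxE.
    by under eq_fun do rewrite !mxE; exact: coord_continuous.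
  have h2 : continuous (fun v => (h v).2).
    move=> v; apply: (cvg_mx (F := nbhs v)) => i j; rewrite !mxE.
    by under eq_fun do rewrite !mxE; exact: coord_continuous.
  by move=> v; exact: (cvg_pair (h1 v) (h2 v)).
have -> : A = h @` (h @^-1` A).
  rewrite eqEsubset; split => [x Ax|x [v Av <-//]].
  exists (row_mx (mxvec x.1) (mxvec x.2)); last first.
    by rewrite /h row_mxKl row_mxKr !mxvecK; case: x Ax.
  by rewrite /preimage /= /h row_mxKl row_mxKr !mxvecK; case: x Ax.
apply: continuous_compact; first exact: continuous_subspaceT.
apply: bounded_closed_compact; last exact: closed_comp.
exists r; split; first exact: num_real.
move=> M rM v /= /Ar hv; apply: le_trans (ltW rM).
have r0 : 0 <= r by apply: le_trans hv.
move: hv; rewrite [in X in X -> _]/Num.Def.normr/= ge_max => /andP[h1 h2].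
rewrite [leLHS]/Num.Def.normr/= mx_normrE (bigmax_le _ r0)//= => -[i j] _ /=.
rewrite (ord1 i); case: (split_ordP j) => j' ->.
  case/mxvec_indexP: j' => a b; apply: le_trans h1.
  rewrite [leRHS]/Num.Def.normr/= mx_normrE.
  apply: le_trans (le_bigmax _ _ (a, b)) => /=.
  by rewrite !mxE.
case/mxvec_indexP: j' => a b; apply: le_trans h2.
rewrite [leRHS]/Num.Def.normr/= mx_normrE.
apply: le_trans (le_bigmax _ _ (a, b)) => /=.
by rewrite !mxE.
Qed.

End Compactness.

(** * Singular value decomposition *)

Section SVD.
Context {R : realType}.

Lemma trmx_mul_cV n (u v : 'cV[R]_n) : u^T *m v = (mxdot u v)%:M.
Proof.
rewrite [LHS]mx11_scalar; congr (_%:M).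
by rewrite /mxdot -[in RHS]mxtrace_tr trmx_mul trmxK mxtrace_mulC /mxtrace big_ord1.
Qed.

Lemma mxdot_deltal n (i : 'I_n) (y : 'cV[R]_n) : mxdot (delta_mx i 0) y = y i 0.
Proof.
have := trmx_mul_cV (delta_mx i 0) y; rewrite trmx_delta -rowE.
by move=> /(congr1 (fun M : 'M[R]_1 => M 0 0)); rewrite !mxE mulr1n.
Qed.

Lemma mxdot_delta n (i : 'I_n) : mxdot (delta_mx i 0 : 'cV[R]_n) (delta_mx i 0) = 1.
Proof. by rewrite mxdot_deltal mxE !eqxx. Qed.

(** The Householder reflection that exchanges [u] and the first basis vector;
    it replaces the completion of [u] to an orthonormal basis. *)
Lemma exists_reflection n (u : 'cV[R]_n.+1) : mxdot u u = 1 ->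
  exists H : 'M[R]_n.+1, [/\ H *m H = 1%:M, H^T = H & H *m delta_mx 0 0 = u].
Proof.
move=> u1; set e : 'cV[R]_n.+1 := delta_mx 0 0.
have ip := inner_product_mxdot (R := R) n.+1 1.
have [<-|ue] := eqVneq e u.
  by exists 1%:M; rewrite mulmx1 mul1mx trmx1.
pose w := e - u; pose c := (mxdot w e)^-1.
have we : mxdot w w = 2 * mxdot w e.
  rewrite /w !(dotBr ip, dotBl ip) u1 /e mxdot_delta (mxdotC u); ring.
have we0 : mxdot w e != 0.
  apply/eqP => h; move: ue; rewrite -subr_eq0 => /eqP; apply.
  by apply: (enorm_eq0 ip); rewrite /enorm -/w we h mulr0 sqrtr0.
exists (1%:M - c *: (w *m w^T)); split.
- set X := c *: _; have XX : X *m X = 2 *: X.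
    rewrite /X -!scalemxAl -!scalemxAr mulmxA -(mulmxA w) trmx_mul_cV we.
    rewrite mul_mx_scalar -scalemxAl !scalerA; congr (_ *: _).
    by rewrite /c; field.
  rewrite mulmxBr mulmx1 mulmxBl mul1mx XX scaler_nat mulr2n.
  by rewrite opprB addrK subrK.
- by rewrite linearB /= linearZ /= trmx1 trmx_mul trmxK.
- rewrite mulmxBl mul1mx -scalemxAl -mulmxA trmx_mul_cV mul_mx_scalar scalerA.
  by rewrite /c mulVf// scale1r /w subKr.
Qed.

Lemma mxdot_orthol m n (U : 'M[R]_m) (X Y : 'M[R]_(m, n)) :
  U *m U^T = 1%:M -> mxdot (U *m X) (U *m Y) = mxdot X Y.
Proof. by move=> /mulmx1C UU; rewrite mxdot_mull mulmxA UU mul1mx. Qed.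

Lemma mxdot_row_mx m n p (A C : 'M[R]_(m, n)) (B D : 'M[R]_(m, p)) :
  mxdot (row_mx A B) (row_mx C D) = mxdot A C + mxdot B D.
Proof. by rewrite /mxdot tr_row_mx mul_row_col mxtraceD. Qed.

Lemma mxdot_col_mx m n p (A C : 'M[R]_(m, n)) (B D : 'M[R]_(p, n)) :
  mxdot (col_mx A B) (col_mx C D) = mxdot A C + mxdot B D.
Proof. by rewrite -mxdot_trmx !tr_col_mx mxdot_row_mx !mxdot_trmx. Qed.

Lemma exists_max_bilinear m n (A : 'M[R]_(m.+1, n.+1)) :
  exists (u : 'cV[R]_m.+1) (v : 'cV[R]_n.+1),
    [/\ mxdot u u = 1, mxdot v v = 1 &
      forall (x : 'cV[R]_m.+1) (y : 'cV[R]_n.+1),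
        mxdot x x = 1 -> mxdot y y = 1 ->
        mxdot x (A *m y) <= mxdot u (A *m v)].
Proof.
pose S := [set p : 'cV[R]_m.+1 * 'cV[R]_n.+1 | mxdot p.1 p.1 = 1 /\ mxdot p.2 p.2 = 1].
have ip1 := inner_product_mxdot (R := R) m.+1 1.
have ip2 := inner_product_mxdot (R := R) n.+1 1.
have cS : compact S.
  apply: (@compact_mx_pair _ _ _ _ _ _ 1).
    move=> [x y] [/= x1 y1]; rewrite [leLHS]/Num.Def.normr/= ge_max; apply/andP; split.
      by apply: le_trans (norm_le_enorm ip1 x) _; rewrite /enorm x1 sqrtr1.
    by apply: le_trans (norm_le_enorm ip2 y) _; rewrite /enorm y1 sqrtr1.
  have -> : S = (fun p : 'cV[R]_m.+1 * 'cV[R]_n.+1 => mxdot p.1 p.1) @^-1` [set 1] `&`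
     (fun p : 'cV[R]_m.+1 * 'cV[R]_n.+1 => mxdot p.2 p.2) @^-1` [set 1] by [].
  apply: closedI; apply: closed_comp; try exact: closed_eq.
    by move=> p _; apply: (cvg_dot ip1); exact: cvg_fst.
  by move=> p _; apply: (cvg_dot ip2); exact: cvg_snd.
have S0 : S !=set0.
  by exists (delta_mx 0 0, delta_mx 0 0); rewrite /S /= !mxdot_delta.
have fc : {within S,
    continuous (fun p : 'cV[R]_m.+1 * 'cV[R]_n.+1 => mxdot p.1 (A *m p.2))}.
  apply: continuous_subspaceT => p; apply: (cvg_dot ip1); first exact: cvg_fst.
  by apply: cvg_mulmx; [exact: cvg_cst|exact: cvg_snd].
have [[u v] /set_mem[/= u1 v1] uv] := compact_EVT_max S0 cS fc.
exists u, v; split => // x y x1 y1.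
by have := uv (x, y); apply; apply/mem_set; split.
Qed.

(** If the corner entry is the maximum of the bilinear form on unit vectors, it
    bounds the norm of the first row [r]: test the form on the first basis vector
    and [r / |r|].  As the corner is an entry of [r], the others vanish. *)
Lemma max_corner_row m n (B : 'M[R]_(1 + m, 1 + n)) :
  (forall (x : 'cV[R]_(1 + m)) (y : 'cV[R]_(1 + n)),
     mxdot x x = 1 -> mxdot y y = 1 -> mxdot x (B *m y) <= B 0 0) ->
  ursubmx B = 0.
Proof.
move=> Bmax.
have ip := inner_product_mxdot (R := R) (1 + n) 1.
pose r := row 0 B; pose e : 'cV[R]_(1 + m) := delta_mx 0 0.
have e1 : mxdot e e = 1 by exact: mxdot_delta.
have eB (y : 'cV[R]_(1 + n)) : mxdot e (B *m y) = mxdot r^T y.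
  rewrite mxdotC mxdot_mull /e mxdotC; congr (mxdot _ y).
  by rewrite /r rowE trmx_mul trmx_delta.
have [r0|r0] := eqVneq (enorm mxdot r^T) 0.
  have /(congr1 trmx) := enorm_eq0 ip r0; rewrite trmxK trmx0 => rE.
  apply/matrixP => i j; rewrite !mxE.
  have /(congr1 (fun M : 'rV_(1 + n) => M 0 (rshift 1 j))) := rE.
  by rewrite !mxE => <-; congr (B _ _); apply/val_inj; rewrite /= ord1.
have rp : 0 < enorm mxdot r^T by rewrite lt0r r0 enorm_ge0.
have rB : enorm mxdot r^T <= B 0 0.
  have := Bmax e ((enorm mxdot r^T)^-1 *: r^T) e1.
  rewrite eB (mxdotZl, dotZr ip) (dotZr ip) -(sqr_enorm ip) expr2.
  by rewrite mulKf// mulVf// => /(_ erefl).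
have : mxdot r^T r^T <= B 0 0 ^+ 2.
  by rewrite -(sqr_enorm ip) ler_pXn2r// nnegrE ?enorm_ge0// (le_trans _ rB)// enorm_ge0.
rewrite mxdot_trmx -[r](hsubmxK (n1 := 1)) mxdot_row_mx.
rewrite [X in X + _]mxdotE !big_ord1 !mxE.
rewrite (_ : lshift n 0 = 0); last exact/val_inj.
rewrite -expr2 gerDl => rs.
have ip' := inner_product_mxdot (R := R) 1 n.
have rs0 : rsubmx (r : 'rV_(1 + n)) = 0.
  by apply: (enorm_eq0 ip'); apply: ler0_sqrtr.
apply/matrixP => i j; rewrite !mxE.
have /(congr1 (fun M : 'rV_n => M 0 j)) := rs0.
by rewrite !mxE => <-; congr (B _ _); apply/val_inj; rewrite /= ord1.
Qed.

Lemma max_corner_diag m n (B : 'M[R]_(1 + m, 1 + n)) :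
  (forall (x : 'cV[R]_(1 + m)) (y : 'cV[R]_(1 + n)),
     mxdot x x = 1 -> mxdot y y = 1 -> mxdot x (B *m y) <= B 0 0) ->
  B = block_mx (B 0 0)%:M 0 0 (drsubmx B).
Proof.
move=> Bmax; rewrite -[LHS]submxK max_corner_row//.
have dl : dlsubmx B = 0.
  apply: trmx_inj; rewrite trmx_dlsub trmx0; apply: max_corner_row => x y x1 y1.
  by rewrite mxE -(mxdotC (B^T *m y)) mxdot_mull trmxK Bmax.
rewrite dl; congr block_mx.
rewrite [LHS]mx11_scalar !mxE; congr ((B _ _)%:M); exact/val_inj.
Qed.

(** Reflect a maximising pair of the bilinear form of [A] to the first basis
    vectors.  The matrix becomes block diagonal; recurse on the lower block, whose
    largest singular value is a value of the same form. *)
Lemma exists_singular_values m n (A : 'M[R]_(m, n)) :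
  exists s, is_singular_values A s.
Proof.
elim: m n A => [|m IHm] [|n] A.
- exists [::]; split => //; exists 1%:M, 1%:M.
  by split; rewrite ?trmx1 ?mulmx1//; apply/matrixP => -[].
- exists [::]; split; rewrite ?min0n//; exists 1%:M, 1%:M.
  by split; rewrite ?trmx1 ?mulmx1//; apply/matrixP => -[].
- exists [::]; split; rewrite ?minn0//; exists 1%:M, 1%:M.
  by split; rewrite ?trmx1 ?mulmx1//; apply/matrixP => ? -[].
have [u [v [u1 v1 uv]]] := exists_max_bilinear A.
have [H [HH Ht Hu]] := exists_reflection u1.
have [K [KK Kt Kv]] := exists_reflection v1.
pose B : 'M[R]_(1 + m, 1 + n) := H *m A *m K.
have BA (x : 'cV[R]_(1 + m)) (y : 'cV[R]_(1 + n)) :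
    mxdot x (B *m y) = mxdot (H *m x) (A *m (K *m y)).
  by rewrite mxdot_mull Ht /B !mulmxA.
have AB : A = H *m B *m K.
  by rewrite /B !mulmxA HH mul1mx -mulmxA KK mulmx1.
clearbody B.
have HHt : H *m H^T = 1%:M by rewrite Ht.
have KKt : K *m K^T = 1%:M by rewrite Kt.
have B00 : B 0 0 = mxdot u (A *m v).
  by rewrite -Hu -Kv -BA mxdot_deltal -colE [RHS]mxE.
have Bmax (x : 'cV[R]_(1 + m)) (y : 'cV[R]_(1 + n)) :
    mxdot x x = 1 -> mxdot y y = 1 -> mxdot x (B *m y) <= B 0 0.
  by move=> x1 y1; rewrite B00 BA uv// mxdot_orthol.
have [s' [ss' sorteds' poss' [U [V [UU VV A'E]]]]] := IHm _ (drsubmx B).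
have BE := max_corner_diag Bmax.
have B0 : 0 <= B 0 0.
  have := uv (- u) v; rewrite (dotNl (inner_product_mxdot _ _)) -B00.
  rewrite (dotNl (inner_product_mxdot _ _)) (dotNr (inner_product_mxdot _ _)) opprK.
  by move=> /(_ u1 v1); lra.
exists (B 0 0 :: s'); split.
- by rewrite /= ss' minnSS.
- rewrite /=; case: s' ss' sorteds' poss' A'E => // s0 s' ss' sorteds' poss' A'E.
  rewrite /= in sorteds' *; rewrite sorteds' andbT.
  have m0 : (0 < m)%N by move: ss'; case: (m) => //; rewrite min0n.
  have n0 : (0 < n)%N by move: ss'; case: (n) => //; rewrite minn0.
  pose e1 : 'cV[R]_m := delta_mx (Ordinal m0) 0.
  pose e2 : 'cV[R]_n := delta_mx (Ordinal n0) 0.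
  have := Bmax (col_mx 0 (U *m e1)) (col_mx 0 (V *m e2)).
  rewrite BE mul_block_col !mxdot_col_mx !mul0mx !mulmx0 !add0r ?addr0.
  rewrite !(dot0l (inner_product_mxdot _ _)) !add0r !mxdot_orthol//.
  rewrite !mxdot_delta -BE => /(_ erefl erefl).
  rewrite A'E -!mulmxA [V^T *m _]mulmxA (mulmx1C VV) mul1mx mxdot_orthol//.
  by rewrite mxdot_deltal -colE !mxE.
- by rewrite /= B0.
pose U1 : 'M[R]_(1 + m) := block_mx 1%:M 0 0 U.
pose V1 : 'M[R]_(1 + n) := block_mx 1%:M 0 0 V.
have UU1 : U1 *m U1^T = 1%:M.
  rewrite tr_block_mx !trmx0 trmx1 mulmx_block.
  by rewrite !(mul0mx, mulmx0, addr0, add0r) mulmx1 UU -scalar_mx_block.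
have VV1 : V1 *m V1^T = 1%:M.
  rewrite tr_block_mx !trmx0 trmx1 mulmx_block.
  by rewrite !(mul0mx, mulmx0, addr0, add0r) mulmx1 VV -scalar_mx_block.
pose S : 'M[R]_(1 + m, 1 + n) :=
  \matrix_(i, j) (if i == j :> nat then (B 0 0 :: s')`_i else 0).
have SE : S = block_mx (B 0 0)%:M 0 0
    (\matrix_(i < m, j < n) (if i == j :> nat then s'`_i else 0)).
  apply/matrixP => i j; rewrite [LHS]mxE.
  case: (split_ordP i) => i' ->; case: (split_ordP j) => j' ->.
  - by rewrite block_mxEul !ord1 mxE mulr1n.
  - by rewrite block_mxEur ord1 mxE.
  - by rewrite block_mxEdl ord1 mxE.
  - by rewrite block_mxEdr mxE.
have BS : B = U1 *m S *m V1^T.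
  rewrite {1}BE A'E SE tr_block_mx !trmx0 trmx1 !mulmx_block.
  by rewrite !(mul0mx, mulmx0, addr0, add0r) mulmx1 mul1mx.
exists (H *m U1), (K *m V1); split.
- by rewrite trmx_mul mulmxA -(mulmxA H) UU1 mulmx1.
- by rewrite trmx_mul mulmxA -(mulmxA K) VV1 mulmx1.
by rewrite AB [in LHS]BS trmx_mul Kt !mulmxA.
Qed.

Local Notation Sdiag m n s :=
  (\matrix_(i < m, j < n) (if i == j :> nat then s`_i else (0 : R))).

Lemma is_singular_values_trmx m n (A : 'M[R]_(m, n)) s :
  is_singular_values A s -> is_singular_values A^T s.
Proof.
move=> [ss sorteds poss [U [V [UU VV AE]]]]; split => //; first by rewrite minnC.
exists V, U; split => //.
rewrite AE !trmx_mul trmxK -!mulmxA; congr (_ *m (_ *m _)).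
by apply/matrixP => i j; rewrite !mxE eq_sym; case: eqP => // ->.
Qed.

(** Padding [s] with zeros by [nth] covers the case of more columns than rows. *)
Lemma singular_gram m n (s : seq R) : size s = minn m n ->
  (Sdiag m n s)^T *m Sdiag m n s = diag_mx (\row_(j < n) s`_j ^+ 2).
Proof.
move=> ss; apply/matrixP => i j; rewrite !mxE.
have [im|im] := ltnP i m.
  rewrite (bigD1 (Ordinal im))//= big1 ?addr0; last first.
    move=> l; rewrite -val_eqE /= => /negPf li; rewrite !mxE li mul0r.
    by [].
  rewrite !mxE /= eqxx -val_eqE /= eq_sym.
  have -> : (j == i :> nat) = (i == j :> nat) by rewrite eq_sym.
  by case: eqP => [->|]; rewrite ?mulr0 ?mulr0n// mulr1n expr2.
rewrite big1; last first.
  move=> l _; rewrite !mxE; case: eqP => [li|]; last by rewrite mul0r.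
  by move: (ltn_ord l); rewrite li ltnNge im.
rewrite nth_default; first by rewrite expr0n /= mul0rn.
by rewrite ss (leq_trans (geq_minl _ _)).
Qed.

(** For more columns than rows the bound is 0, in accordance with the padding. *)
Lemma singular_value_lower_bound m n p (A : 'M[R]_(m, n)) (X : 'M[R]_(n, p)) s :
  (0 < n)%N -> is_singular_values A s ->
  s`_n.-1 ^+ 2 * mxdot X X <= mxdot (A *m X) (A *m X).
Proof.
move=> n0 [ss sorteds poss [U [V [UU VV ->]]]].
have [mn|nm] := ltnP m n.
  rewrite nth_default; first by rewrite expr0n /= mul0r mxdot_ge0.
  by rewrite ss (leq_trans (geq_minl _ _))// -ltnS prednK.
have VtV : V^T *m V^T^T = 1%:M by rewrite trmxK; exact: mulmx1C.
rewrite -!mulmxA mxdot_orthol// -(mxdot_orthol _ _ VtV).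
move: (V^T *m X) => Y; rewrite mxdot_mull mulmxA singular_gram//.
rewrite mul_diag_mx mxdotE [leRHS]mxdotE mulr_sumr; apply: ler_sum => i _.
rewrite mulr_sumr; apply: ler_sum => j _; rewrite !mxE [leRHS]mulrCA.
apply: ler_wpM2r; first by rewrite -expr2 sqr_ge0.
have sn : size s = n by rewrite ss (minn_idPr nm).
rewrite ler_pXn2r// ?nnegrE ?(allP poss) ?mem_nth ?sn ?prednK//.
apply: (sorted_leq_nth ge_trans lexx 0 sorteds); rewrite ?inE ?sn ?prednK//.
by rewrite -ltnS prednK.
Qed.

Lemma exists_singular_vector m n (A : 'M[R]_(m, n)) s j :
  (j < n)%N -> is_singular_values A s ->
  exists2 v : 'cV[R]_n, mxdot v v = 1 & A^T *m A *m v = s`_j ^+ 2 *: v.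
Proof.
move=> jn [ss sorteds poss [U [V [UU VV ->]]]].
pose e : 'cV[R]_n := delta_mx (Ordinal jn) 0.
exists (V *m e); first by rewrite mxdot_orthol// mxdot_delta.
rewrite !trmx_mul trmxK -!mulmxA (mulmxA V^T) (mulmx1C VV) mul1mx.
rewrite (mulmxA U^T) (mulmx1C UU) mul1mx (mulmxA (_^T) _ e) singular_gram//.
rewrite scalemxAr; congr (_ *m _); apply/matrixP => a b.
rewrite mul_diag_mx !mxE; case: eqP => [->|]; first by [].
by rewrite !mulr0.
Qed.

Lemma sigmaP m n (A : 'M[R]_(m, n)) :
  is_singular_values A (xget [::] (is_singular_values A)).
Proof. exact: (xgetPex [::] (exists_singular_values A)). Qed.

Lemma sigma_lower_bound m n p (A : 'M[R]_(m, n)) (X : 'M[R]_(n, p)) :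
  (0 < n)%N -> sigma n A ^+ 2 * mxdot X X <= mxdot (A *m X) (A *m X).
Proof. by move=> n0; apply: singular_value_lower_bound => //; exact: sigmaP. Qed.

Lemma sigma_trmx_lower_bound m n p (A : 'M[R]_(m, n)) (X : 'M[R]_(p, m)) :
  (0 < m)%N -> sigma m A ^+ 2 * mxdot X X <= mxdot (X *m A) (X *m A).
Proof.
move=> m0; rewrite -(mxdot_trmx (X *m A)) -(mxdot_trmx X) trmx_mul.
apply: singular_value_lower_bound => //; apply: is_singular_values_trmx.
exact: sigmaP.
Qed.

Lemma exists_sigma_vector m n (A : 'M[R]_(m, n)) i : (0 < i <= n)%N ->
  exists2 v : 'cV[R]_n, mxdot v v = 1 & A^T *m A *m v = sigma i A ^+ 2 *: v.
Proof.
move=> /andP[i0 i_n]; apply: exists_singular_vector; last exact: sigmaP.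
by rewrite prednK.
Qed.

Lemma exists_sigma_vector_trmx m n (A : 'M[R]_(m, n)) i : (0 < i <= m)%N ->
  exists2 u : 'cV[R]_m, mxdot u u = 1 & A *m A^T *m u = sigma i A ^+ 2 *: u.
Proof.
move=> /andP[i0 im].
have im' : (i.-1 < m)%N by rewrite prednK.
have := exists_singular_vector im' (is_singular_values_trmx (sigmaP A)).
by rewrite trmxK.
Qed.

Lemma sigma_ge0 m n (A : 'M[R]_(m, n)) i : 0 <= sigma i A.
Proof.
have [ss _ poss _] := sigmaP A; rewrite /sigma.
set s := xget _ _ in ss poss *; have [h|h] := ltnP i.-1 (size s).
  exact: (allP poss _ (mem_nth _ h)).
by rewrite nth_default.
Qed.

Lemma sigma_eq0 m n (A : 'M[R]_(m, n)) i : (minn m n < i)%N -> sigma i A = 0.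
Proof.
have [ss _ _ _] := sigmaP A => h; rewrite /sigma nth_default// ss.
by rewrite -ltnS prednK//; apply: leq_trans h.
Qed.

Lemma sigma_gt0_free m n (A : 'M[R]_(m, n)) (B : 'M[R]_(n, m)) : (0 < n)%N ->
  B *m A = 1%:M -> 0 < sigma n A.
Proof.
move=> n0 BA; rewrite lt0r sigma_ge0 andbT; apply/eqP => s0.
have [|v v1] := @exists_sigma_vector _ _ A n; first by rewrite n0 leqnn.
rewrite s0 expr0n /= scale0r => Av.
have : mxdot (A *m v) (A *m v) = 0.
  by rewrite mxdot_mull mulmxA Av mxdotC (dot0l (inner_product_mxdot _ _)).
move=> Av0; have {}Av0 : A *m v = 0.
  by apply: (enorm_eq0 (inner_product_mxdot _ _)); rewrite /enorm Av0 sqrtr0.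
move: v1; rewrite -[v]mul1mx -BA -mulmxA Av0 mulmx0.
rewrite (dot0l (inner_product_mxdot _ _)) => /eqP.
by rewrite eq_sym oner_eq0.
Qed.

Lemma sigma_gt0_full m n (A : 'M[R]_(m, n)) (B : 'M[R]_(n, m)) : (0 < m)%N ->
  A *m B = 1%:M -> 0 < sigma m A.
Proof.
move=> m0 AB; rewrite lt0r sigma_ge0 andbT; apply/eqP => s0.
have [|v v1] := @exists_sigma_vector_trmx _ _ A m; first by rewrite m0 leqnn.
rewrite s0 expr0n /= scale0r => Av.
have : mxdot (A^T *m v) (A^T *m v) = 0.
  by rewrite mxdot_mull trmxK mulmxA Av mxdotC (dot0l (inner_product_mxdot _ _)).
move=> Av0; have {}Av0 : A^T *m v = 0.
  by apply: (enorm_eq0 (inner_product_mxdot _ _)); rewrite /enorm Av0 sqrtr0.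
move: v1; rewrite -[v]mul1mx -(trmx1 _ m) -AB trmx_mul -mulmxA Av0 mulmx0.
rewrite (dot0l (inner_product_mxdot _ _)) => /eqP.
by rewrite eq_sym oner_eq0.
Qed.

End SVD.

(** * Calculus of smooth maps *)

Section SmoothCalculus.
Context {R : realType}.

(** The Taylor expansions agree near the point, and they determine the
    differential. *)
Lemma near_eq_differentiable (V W : normedModType R) (f g : V -> W) x :
  (\near x, f x = g x) -> differentiable f x -> differentiable g x.
Proof.
move=> fg df; have fgx : f x = g x := nbhs_singleton fg.
have dg : g \o shift x = cst (g x) + 'd f x +o_ 0 id.
  have /eqaddoP fo := diff_locally df.
  apply/eqaddoP => e e0.
  have fg' : \forall y \near (0 : V), f (y + x) = g (y + x).
    by move: fg; rewrite (near_shift 0) subr0.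
  near=> y; rewrite !fctE /= -fgx -(near fg' y)//.
  by near: y; exact: fo.
have dfc : continuous ('d f x) by exact: diff_continuous.
by apply/diff_locallyP; rewrite (diff_unique dfc dg).
Unshelve. all: by end_near. Qed.

Section Generic.
Context {V : normedModType R}.
Variable U : set V.
Hypothesis oU : open U.

(** The rules for derivatives hold only on [U] (for inverses they need a nonzero
    denominator), so the inductions below compare functions on [U]. *)
Lemma Cp_on_ext (W : normedModType R) p (f g : V -> W) :
  (forall x, U x -> f x = g x) -> Cp_on p U f -> Cp_on p U g.
Proof.
have near_fg (h k : V -> W) : (forall x, U x -> h x = k x) ->
    forall x, U x -> \near x, h x = k x.
  move=> fg x Ux; have := open_nbhs_nbhs (conj oU Ux).
  by apply: filterS => y; exact: fg.
elim: p f g => [|p IHp] f g fg /=.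
  move=> cf x Ux; change (g @ x --> g x); rewrite -(fg _ Ux).
  apply: cvg_trans (cf x Ux); apply: near_eq_cvg.
  exact: near_fg Ux.
move=> [df Df]; split => [x Ux|v].
  by apply: near_eq_differentiable (df x Ux); exact: near_fg Ux.
apply: IHp (Df v) => x Ux; apply: near_eq_derive; exact: near_fg Ux.
Qed.

Lemma Cp_on_pred (W : normedModType R) p (f : V -> W) :
  Cp_on p.+1 U f -> Cp_on p U f.
Proof.
elim: p f => [|p IHp] f [df Df].
  by move=> x Ux; apply: differentiable_continuous; exact: df.
by split => // v; apply: IHp; exact: Df.
Qed.

Lemma Cp_on_cst (W : normedModType R) p (a : W) : Cp_on p U (cst a).
Proof.
elim: p a => [|p IHp] a /=.
  by move=> x _; exact: cst_continuous.
split => [x _|v]; first exact: differentiable_cst.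
by apply: (Cp_on_ext (f := cst 0)) => // x _; rewrite derive_cst.
Qed.

Lemma Cp_on_linear (W : normedModType R) p (f : V -> W) :
  linear f -> continuous f -> Cp_on p U f.
Proof.
move=> lf cf; pose fl := GRing.isLinear.Build _ _ _ _ _ lf.
pose fL : {linear V -> W} := HB.pack f fl.
case: p => [|p] /=; first by move=> x _; exact: cf.
split => [x _|v]; first exact: (linear_differentiable (f := fL)).
apply: (Cp_on_ext (f := cst (f v))); last exact: Cp_on_cst.
move=> x _; rewrite deriveE; last exact: (linear_differentiable (f := fL)).
by rewrite (diff_lin (f := fL)).
Qed.

Lemma Cp_onD (W : normedModType R) p (f g : V -> W) :
  Cp_on p U f -> Cp_on p U g -> Cp_on p U (fun x => f x + g x).
Proof.
elim: p f g => [|p IHp] f g /=.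
  by move=> cf cg x Ux; apply: cvgD; [exact: cf|exact: cg].
move=> [df Df] [dg Dg]; split => [x Ux|v].
  by apply: differentiableD; [exact: df|exact: dg].
apply: (Cp_on_ext (f := fun x => 'D_v f x + 'D_v g x)); last exact: IHp.
move=> x Ux; apply/esym/deriveD; apply: diff_derivable; [exact: df|exact: dg].
Qed.

Lemma Cp_onM p (f g : V -> R) :
  Cp_on p U f -> Cp_on p U g -> Cp_on p U (fun x => f x * g x).
Proof.
elim: p f g => [|p IHp] f g.
  by move=> cf cg x Ux; apply: cvgM; [exact: cf|exact: cg].
move=> Cf Cg; have [df Df] := Cf; have [dg Dg] := Cg; split => [x Ux|v].
  by apply: differentiableM; [exact: df|exact: dg].
apply: (Cp_on_ext (f := fun x => f x * 'D_v g x + g x * 'D_v f x)).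
  move=> x Ux; apply/esym/deriveM; apply: diff_derivable; [exact: df|exact: dg].
by apply: Cp_onD; apply: IHp;
  [exact: (Cp_on_pred Cf)|exact: Dg|exact: (Cp_on_pred Cg)|exact: Df].
Qed.

Lemma Cp_onV p (f : V -> R) : (forall x, U x -> f x != 0) ->
  Cp_on p U f -> Cp_on p U (fun x => (f x)^-1).
Proof.
move=> f0; elim: p => [|p IHp].
  by move=> /= cf x Ux; exact: (cvgV (f0 x Ux) (cf x Ux)).
move=> Cf; have [df Df] := Cf; split => [x Ux|v].
  by apply: differentiableV; [exact: df|exact: f0].
apply: (Cp_on_ext (f := fun x => cst (-1) x * ((f x)^-1 * (f x)^-1) * 'D_v f x)).
  move=> x Ux; apply/esym; rewrite deriveV; last 2 first.
  - exact: f0.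
  - by apply: diff_derivable; exact: df.
  by rewrite expr2 invfM /= mulN1r.
apply: Cp_onM; last exact: Df.
apply: Cp_onM; first exact: Cp_on_cst.
by apply: Cp_onM; apply: IHp; exact: (Cp_on_pred Cf).
Qed.

Lemma Cp_on_sum (W : normedModType R) p I (r : seq I) (P : pred I) (f : I -> V -> W) :
  (forall i, P i -> Cp_on p U (f i)) -> Cp_on p U (fun x => \sum_(i <- r | P i) f i x).
Proof.
move=> Cf; elim: r => [|i r IHr].
  have -> : (fun x => \sum_(i <- [::] | P i) f i x) = cst 0.
    by apply/funext => x; rewrite big_nil.
  exact: Cp_on_cst.
have [Pi|Pi] := boolP (P i).
  have -> : (fun x => \sum_(j <- i :: r | P j) f j x) =
      (fun x => f i x + \sum_(j <- r | P j) f j x).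
    by apply/funext => x; rewrite big_cons Pi.
  by apply: Cp_onD; first exact: Cf.
have -> : (fun x => \sum_(j <- i :: r | P j) f j x) =
    (fun x => \sum_(j <- r | P j) f j x).
  by apply/funext => x; rewrite big_cons (negPf Pi).
exact: IHr.
Qed.

Lemma Cp_on_prod p I (r : seq I) (P : pred I) (f : I -> V -> R) :
  (forall i, P i -> Cp_on p U (f i)) -> Cp_on p U (fun x => \prod_(i <- r | P i) f i x).
Proof.
move=> Cf; elim: r => [|i r IHr].
  have -> : (fun x => \prod_(i <- [::] | P i) f i x) = cst 1.
    by apply/funext => x; rewrite big_nil.
  exact: Cp_on_cst.
have [Pi|Pi] := boolP (P i).
  have -> : (fun x => \prod_(j <- i :: r | P j) f j x) =
      (fun x => f i x * \prod_(j <- r | P j) f j x).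
    by apply/funext => x; rewrite big_cons Pi.
  by apply: Cp_onM; first exact: Cf.
have -> : (fun x => \prod_(j <- i :: r | P j) f j x) =
    (fun x => \prod_(j <- r | P j) f j x).
  by apply/funext => x; rewrite big_cons (negPf Pi).
exact: IHr.
Qed.

Lemma differentiable_mx m n (f : V -> 'M[R]_(m, n)) x :
  (forall i j, differentiable (fun x => f x i j) x) -> differentiable f x.
Proof.
move=> df.
have -> : f = \sum_(i < m) \sum_(j < n) (fun x => f x i j *: delta_mx i j).
  apply/funext => y; rewrite fct_sumE [LHS]matrix_sum_delta.
  by apply: eq_bigr => i _; rewrite fct_sumE.
apply: differentiable_sum => i; apply: differentiable_sum => j.
exact: differentiableZl.
Qed.

Lemma Cp_on_mx p m n (f : V -> 'M[R]_(m, n)) :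
  (forall i j, Cp_on p U (fun x => f x i j)) -> Cp_on p U f.
Proof.
elim: p f => [|p IHp] f.
  by move=> /= cf x Ux; apply: (cvg_mx (F := nbhs x)) => i j; exact: cf.
move=> Cf.
have df x : U x -> differentiable f x.
  by move=> Ux; apply: differentiable_mx => i j; have [+ _] := Cf i j; apply.
split => // v; apply: IHp => i j; have [_ /(_ v) Dij] := Cf i j.
apply: (Cp_on_ext _ Dij) => x Ux; rewrite derive_mx ?mxE//.
by apply: diff_derivable; exact: df.
Qed.

Lemma Cp_on_entry p m n (f : V -> 'M[R]_(m, n)) i j :
  Cp_on p U f -> Cp_on p U (fun x => f x i j).
Proof.
elim: p f => [|p IHp] f.
  by move=> /= cf x Ux; exact: (cvg_entry (i := i) (j := j) (cf x Ux)).
move=> [df Df]; split => [x Ux|v].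
  exact: (@differentiable_comp _ _ _ _ f (fun M : 'M[R]_(m, n) => M i j) x
            (df x Ux) (@differentiable_coord _ m n (f x) i j)).
apply: (Cp_on_ext (f := fun x => 'D_v f x i j)); last exact: (IHp _ (Df v)).
by move=> x Ux; rewrite derive_mx ?mxE//; apply: diff_derivable; exact: df.
Qed.

Lemma Cp_on_mulmx p m n q (f : V -> 'M[R]_(m, n)) (g : V -> 'M[R]_(n, q)) :
  Cp_on p U f -> Cp_on p U g -> Cp_on p U (fun x => f x *m g x).
Proof.
move=> Cf Cg; apply: Cp_on_mx => i j; under eq_fun do rewrite mxE.
by apply: Cp_on_sum => l _; apply: Cp_onM; exact: Cp_on_entry.
Qed.

Lemma Cp_on_mxN p m n (f : V -> 'M[R]_(m, n)) :
  Cp_on p U f -> Cp_on p U (fun x => - f x).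
Proof.
move=> Cf; apply: (Cp_on_ext (f := fun x => cst ((-1)%:M) x *m f x)).
  by move=> x _; rewrite /= mul_scalar_mx scaleN1r.
by apply: Cp_on_mulmx => //; exact: Cp_on_cst.
Qed.

Lemma Cp_on_det p n (f : V -> 'M[R]_n) :
  Cp_on p U f -> Cp_on p U (fun x => \det (f x)).
Proof.
move=> Cf; apply: Cp_on_sum => s _; apply: Cp_onM; first exact: Cp_on_cst.
by apply: Cp_on_prod => i _; exact: Cp_on_entry.
Qed.

(** Cramer's rule reduces inversion to determinants. *)
Lemma Cp_on_invmx p n (f : V -> 'M[R]_n) : (forall x, U x -> f x \in unitmx) ->
  Cp_on p U f -> Cp_on p U (fun x => invmx (f x)).
Proof.
move=> f1 Cf.
apply: (Cp_on_ext (f := fun x => (\det (f x))^-1 *: \adj (f x))).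
  by move=> x Ux; rewrite /invmx f1.
apply: Cp_on_mx => i j; under eq_fun do rewrite 2!mxE.
apply: Cp_onM; first apply: Cp_onV.
- by move=> x /f1; rewrite unitmxE unitfE.
- exact: Cp_on_det.
rewrite /cofactor; apply: Cp_onM; first exact: Cp_on_cst.
apply: Cp_on_det; apply: Cp_on_mx => a b; under eq_fun do rewrite !mxE.
exact: Cp_on_entry.
Qed.

End Generic.

Lemma continuous_det n : continuous (fun M : 'M[R]_n => \det M).
Proof.
move=> M; have : Cp_on 0 setT (fun M : 'M[R]_n => \det M); last exact.
apply: Cp_on_det; first exact: openT.
by move=> x _; exact: cvg_id.
Qed.

Lemma open_unitmx (V : topologicalType) n (f : V -> 'M[R]_n) :
  continuous f -> open [set x | f x \in unitmx].
Proof.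
move=> cf; rewrite (_ : mkset _ = (fun x => \det (f x)) @^-1` [set y | y != 0]).
  apply: open_comp; last exact: open_neq.
  by move=> x _; apply: (cvg_comp f); [exact: cf|exact: continuous_det].
by apply/funext => x /=; rewrite unitmxE unitfE.
Qed.

Lemma invmx_continuous n (A : 'M[R]_n) : A \in unitmx -> {for A, continuous (@invmx R n)}.
Proof.
move=> A1; pose U := [set x : 'M[R]_n | x \in unitmx].
have oU : open U by apply: open_unitmx => x; exact: cvg_id.
have : Cp_on 0 U (@invmx R n); last exact.
by apply: (Cp_on_invmx oU) => // x _; exact: cvg_id.
Qed.

End SmoothCalculus.

(** * Riemannian distance of a submanifold *)

Section RiemannianDistance.
Context {R : realType} {V : normedModType R} {dot : V -> V -> R}.
Hypothesis ip : inner_product dot.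
Implicit Types (X Y : set V) (p q u : V) (g : R -> V).

Lemma is_derive_dot g (t : R) (dg : V) u :
  is_derive t (1 : R) g dg -> is_derive t (1 : R) (fun t => dot (g t) u) (dot dg u).
Proof.
move=> [gt <-].
have h : (h^-1 *: (dot (g (h *: (1 : R) + t)) u - dot (g t) u)) @[h --> 0^'] -->
    dot ('D_1 g t) u.
  have : dot (h^-1 *: (g (h *: (1 : R) + t) - g t)) u @[h --> 0^'] --> dot ('D_1 g t) u.
    by apply: (cvg_dot ip); [exact: gt|exact: cvg_cst].
  by under eq_fun do rewrite (dotZl ip) (dotBl ip).
split; first by apply/cvg_ex; exists (dot ('D_1 g t) u).
exact: cvg_lim h.
Qed.

Lemma integrable_unit_itv (f : R -> R) : continuous f ->
  (@lebesgue_measure R).-integrable `[0, 1] (EFin \o f).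
Proof.
move=> cf; apply: continuous_compact_integrable; first exact: segment_compact.
exact: continuous_subspaceT.
Qed.

(** Integrate the component of the velocity along the chord [u = q - p], which is
    at most [|u|] times the speed. *)
Lemma enorm_sub_le_curve_length X p q g : curve_in X p q g ->
  ((enorm dot (q - p))%:E <= curve_length dot g)%E.
Proof.
move=> [dg cdg _ g0 g1]; set u := q - p.
have ndg_cont : continuous (fun t => enorm dot (derive1 g t)).
  by move=> t; apply: (cvg_enorm ip); exact: cdg.
have ndg0 t : (0 <= (enorm dot (derive1 g t))%:E)%E by rewrite lee_fin enorm_ge0.
have mitv : measurable (`[0%R, 1%R]%classic : set (measurableTypeR R)) by [].
have mndg := measurable_int _ (integrable_unit_itv ndg_cont).
have dh t : is_derive t (1 : R) (fun t => dot (g t) u) (dot (derive1 g t) u).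
  by apply: is_derive_dot; rewrite derive1E; apply: derivableP.
have cdh : continuous (fun t => dot (derive1 g t) u).
  by move=> t; apply: (cvg_dot ip); [exact: cdg|exact: cvg_cst].
have ch : continuous (fun t => dot (g t) u).
  move=> t; apply: differentiable_continuous; apply/derivable1_diffP.
  by have [] := dh t.
have FTC : (\int[lebesgue_measure]_(t in `[0%R, 1%R]) (dot (derive1 g t) u)%:E =
    (dot u u)%:E)%E.
  rewrite (@continuous_FTC2 _ _ (fun t => dot (g t) u)) ?ltr01//.
  - by rewrite g0 g1 -EFinB -(dotBl ip).
  - exact: continuous_subspaceT.
  - split=> [t _||]; first by have [] := dh t.
    + by apply: cvg_at_right_filter; exact: ch.
    + by apply: cvg_at_left_filter; exact: ch.
  - by move=> t _; rewrite derive1E; have [_ ->] := dh t.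
have le_int : ((dot u u)%:E <= (enorm dot u)%:E * curve_length dot g)%E.
  rewrite -FTC /curve_length -ge0_integralZl_EFin ?enorm_ge0//.
  under [leRHS]eq_integral do rewrite -EFinM.
  apply: le_integral => //.
  - exact: (integrable_unit_itv cdh).
  - apply: (integrable_unit_itv (f := fun t => enorm dot u * enorm dot (derive1 g t))).
    by move=> t; apply: cvgM; [exact: cvg_cst|exact: ndg_cont].
  - by move=> t _; rewrite lee_fin mulrC (dot_le_enorm ip).
have [->|u0] := eqVneq (enorm dot u) 0; first exact: integral_ge0.
have up : 0 < enorm dot u by rewrite lt0r u0 enorm_ge0.
by move: le_int; rewrite -(sqr_enorm ip) expr2 EFinM lee_pmul2l.
Qed.

Lemma enorm_sub_le_geodist X p q :
  ((enorm dot (q - p))%:E <= geodist dot X p q)%E.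
Proof.
by apply: le_ereal_inf_tmp => _ [g gX <-]; exact: enorm_sub_le_curve_length gX.
Qed.

Lemma geodist_le X p q g (dg : R -> V) C :
  (forall t : R, is_derive t (1 : R) g (dg t)) -> continuous dg ->
  (forall t, t \in `[0, 1] -> X (g t)) -> g 0 = p -> g 1 = q ->
  (forall t, t \in `[0, 1] -> enorm dot (dg t) <= C) ->
  (geodist dot X p q <= C%:E)%E.
Proof.
move=> gdg cdg gX g0 g1 dgC.
have dE : derive1 g = dg by apply/funext => t; rewrite derive1E; have [_ ->] := gdg t.
apply: (@le_trans _ _ (curve_length dot g)).
  apply: ereal_inf_lbound; exists g => //; split => //; last by rewrite dE.
rewrite /curve_length dE.
apply: (@le_trans _ _ (\int[lebesgue_measure]_(t in `[0%R, 1%R]) cst C%:E t)%E).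
  apply: le_integral => //.
  - apply: (integrable_unit_itv (f := fun t => enorm dot (dg t))).
    by move=> t; apply: (cvg_enorm ip); exact: cdg.
  - by apply: (integrable_unit_itv (f := cst C)) => t; exact: cvg_cst.
  - by move=> t; rewrite inE => t01; rewrite lee_fin; exact: dgC.
rewrite integral_cst//= lebesgue_measure_itv/= lte_fin ltr01 oppr0 adde0.
by rewrite mule1.
Qed.

Lemma is_derive_line p u (t : R) : is_derive t (1 : R) (fun t => p + t *: u) u.
Proof.
have h : (h^-1 *: ((p + (h *: (1 : R) + t) *: u) - (p + t *: u))) @[h --> 0^'] --> u.
  apply: cvg_near_cst; near=> h.
  rewrite opprD addrACA subrr add0r -scalerBl addrK scalerA.
  have h0 : h != 0 by near: h; exact: nbhs_dnbhs_neq.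
  by rewrite -[h *: 1]/(h * 1) mulr1 mulVf ?scale1r.
split; first by apply/cvg_ex; exists u.
exact: cvg_lim h.
Unshelve. all: by end_near. Qed.

Lemma geodist_segment X p q :
  (forall t : R, t \in `[0, 1] -> X (p + t *: (q - p))) ->
  geodist dot X p q = (enorm dot (q - p))%:E.
Proof.
move=> pqX; apply/eqP; rewrite eq_le enorm_sub_le_geodist andbT.
apply: (geodist_le (g := fun t => p + t *: (q - p)) (dg := cst (q - p))) => //.
- by move=> t; exact: is_derive_line.
- by move=> t; exact: cvg_cst.
- by rewrite scale0r addr0.
- by rewrite scale1r addrC subrK.
Qed.

(** Balls are convex, so the segment is a shortest curve. *)
Lemma geodist_ball X p q e : (forall x, enorm dot (x - p) < e -> X x) ->
  enorm dot (q - p) < e -> geodist dot X p q = (enorm dot (q - p))%:E.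
Proof.
move=> eX qe; apply: geodist_segment => t; rewrite in_itv/= => /andP[t0 t1].
apply: eX; rewrite addrAC subrr add0r (enormZ ip) ger0_norm//.
by apply: le_lt_trans qe; rewrite ler_piMl// enorm_ge0.
Qed.

End RiemannianDistance.

(** * Linear subspaces *)

Section Subspaces.
Context {R : realType}.

Lemma is_subspace_of_dim_image (V W : normedModType R) r (T : set V)
    (f : {linear V -> W}) :
  injective f -> is_subspace_of_dim r T -> is_subspace_of_dim r (f @` T).
Proof.
move=> finj [b [bfree ->]]; exists (f \o b); split.
  move=> c; under eq_bigr do rewrite /= -linearZ.
  by rewrite -linear_sum -(linear0 f) => /finj; exact: bfree.
rewrite eqEsubset; split => [_ [_ [c _ <-] <-]|_ [c _ <-]].
  by exists c => //; rewrite linear_sum; apply: eq_bigr => i _; rewrite linearZ.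
exists (\sum_i c i *: b i); first by exists c.
by rewrite linear_sum; apply: eq_bigr => i _; rewrite linearZ.
Qed.

Lemma is_subspace_of_dim_setT_rV N : is_subspace_of_dim N [set: 'rV[R]_N].
Proof.
exists (fun i => delta_mx 0 i); split.
  move=> c c0 i; have := congr1 (fun M : 'rV[R]_N => M 0 i) c0.
  rewrite summxE mxE (bigD1 i)//= big1 ?addr0 => [|j /negPf ji].
    by rewrite !mxE !eqxx mulr1.
  by rewrite !mxE eq_sym ji andbF mulr0.
rewrite eqEsubset; split => // v _; exists (v 0) => //.
by rewrite [RHS]row_sum_delta.
Qed.

Lemma is_subspace_of_dim_setT_pair m n p q :
  is_subspace_of_dim (m * n + p * q) [set: 'M[R]_(m, n) * 'M[R]_(p, q)].
Proof.
pose h (v : 'rV[R]_(m * n + p * q)) : 'M[R]_(m, n) * 'M[R]_(p, q) :=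
  (vec_mx (lsubmx v), vec_mx (rsubmx v)).
have hl : linear h by move=> a u v; rewrite /h !linearP.
pose hL : {linear _ -> _} := HB.pack h (GRing.isLinear.Build _ _ _ _ _ hl).
have hK : cancel h (fun p => row_mx (mxvec p.1) (mxvec p.2)).
  by move=> v; rewrite /h /= !vec_mxK hsubmxK.
have -> : [set: 'M[R]_(m, n) * 'M[R]_(p, q)] = hL @` setT.
  rewrite eqEsubset; split => // -[A B] _; exists (row_mx (mxvec A) (mxvec B)) => //.
  by rewrite /= /h row_mxKl row_mxKr !mxvecK.
apply: is_subspace_of_dim_image; last exact: is_subspace_of_dim_setT_rV.
exact: can_inj hK.
Qed.

(** Only the existence of a dimension is claimed: it is shared by all tangent
    spaces through [is_subspace_of_dim_image]. *)
Lemma is_subspace_of_dim_range (U : vectType R) m n (f : {linear U -> 'M[R]_(m, n)}) :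
  exists r, is_subspace_of_dim r (range f).
Proof.
pose W := limg (linfun f); exists (\dim W).
exists (fun i => (vbasis W)`_i); split.
  by apply: freeP; exact: (basis_free (vbasisP W)).
rewrite eqEsubset; split => [_ [u _ <-]|_ [c _ <-]].
  have fW : f u \in W by rewrite -lfunE memv_img// memvf.
  exists (fun i => coord (vbasis W) i (f u)) => //.
  by rewrite -coord_vbasis.
have : \sum_i c i *: (vbasis W)`_i \in W.
  by apply: memv_suml => i _; rewrite memvZ// vbasis_mem// mem_nth// size_tuple.
by move=> /memv_imgP[u _ ->]; exists u => //; rewrite lfunE.
Qed.

(** The form in which all derivatives of quadratic maps are computed below. *)
Lemma is_derive_expansion (V W : normedModType R) (f : V -> W) a v b c :
  (forall h : R, f (h *: v + a) = f a + h *: b + (h * h) *: c) -> is_derive a v f b.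
Proof.
move=> fE.
have H : (h^-1 *: (f (h *: v + a) - f a)) @[h --> 0^'] --> b.
  have : b + h *: c @[h --> 0^'] --> b + (0 : R) *: c.
    apply: cvgD; first exact: cvg_cst.
    by apply: cvgZr_tmp; apply: cvg_within.
  rewrite scale0r addr0; apply: cvg_trans; apply: near_eq_cvg; near=> h.
  have h0 : h != 0 by near: h; exact: nbhs_dnbhs_neq.
  rewrite fE [_ - f a]addrC -!addrA addKr scalerDr !scalerA mulrA mulVf//.
  by rewrite mul1r scale1r.
split; first by apply/cvg_ex; exists b.
exact: cvg_lim H.
Unshelve. all: by end_near. Qed.

End Subspaces.

(** * Manifold of matrices of rank k *)

(** A left inverse [B] of [A] makes [1 - A B] the projection along the range of
    [A] onto the kernel of [B]. *)
Lemma mulmx_retraction_compl (F : realType) m k (A : 'M[F]_(m, k)) (B : 'M[F]_(k, m)) :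
  B *m A = 1%:M -> (1%:M - A *m B) *m A = 0 /\ B *m (1%:M - A *m B) = 0.
Proof.
move=> BA; split; first by rewrite mulmxBl mul1mx -mulmxA BA mulmx1 subrr.
by rewrite mulmxBr mulmx1 mulmxA BA mul1mx subrr.
Qed.

Section RankManifold.
Context {K : realType} {m n k : nat}.
Local Notation D := (full_rank_pairs K m n k).
Local Notation G := (GM K m n k).
Implicit Types (L : 'M[K]_(m, k)) (R : 'M[K]_(k, n)).
Implicit Types (P : 'M[K]_(k, m)) (Q : 'M[K]_(n, k)) (x g : 'M[K]_(m, n)).

(** One-sided inverses [P] of [L] and [Q] of [R] serve as coordinates throughout:
    [x |-> P x Q] sends [L R] to the identity, and full rank is stable where its
    values are invertible. *)
Lemma full_rankP L R : D (L, R) <->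
  exists P Q, P *m L = 1%:M /\ R *m Q = 1%:M.
Proof.
split=> [[/= /eqP Lk /eqP Rk]|[P [Q [PL RQ]]]].
  have /row_fullP[P PL] : row_full L by exact: Lk.
  have /row_freeP[Q RQ] : row_free R by exact: Rk.
  by exists P, Q.
split => /=; apply/eqP.
  by change (row_full L); apply/row_fullP; exists P.
by change (row_free R); apply/row_freeP; exists Q.
Qed.

Lemma full_rank_unit L R P Q : P *m L \in unitmx -> R *m Q \in unitmx -> D (L, R).
Proof.
move=> PL RQ; apply/full_rankP; exists (invmx (P *m L) *m P), (Q *m invmx (R *m Q)).
by rewrite -mulmxA mulVmx// mulmxA mulmxV.
Qed.

Lemma open_full_rank_pairs : open D.
Proof.
rewrite openE => -[L R] /full_rankP[P [Q [PL RQ]]]; rewrite /interior.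
pose O := [set p : 'M[K]_(m, k) * 'M[K]_(k, n) | P *m p.1 \in unitmx] `&`
  [set p : 'M[K]_(m, k) * 'M[K]_(k, n) | p.2 *m Q \in unitmx].
have oO : open O.
  apply: openI; apply: open_unitmx => p.
    by apply: cvg_mulmx; [exact: cvg_cst|exact: cvg_fst].
  by apply: cvg_mulmx; [exact: cvg_snd|exact: cvg_cst].
have : nbhs (L, R) O.
  by apply: open_nbhs_nbhs; split => //; split; rewrite /= (PL, RQ) unitmx1.
by apply: filterS => -[L' R'] [/= h1 h2]; exact: full_rank_unit h1 h2.
Qed.

(** The skeleton (or CUR) decomposition: a matrix of rank [k] is recovered from
    [x Q], [P x] and the invertible [k x k] matrix [P x Q]. *)
Lemma skeleton_decomposition L R P Q : P *m (L *m R) *m Q \in unitmx ->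
  L *m R = L *m R *m Q *m invmx (P *m (L *m R) *m Q) *m (P *m (L *m R)).
Proof.
set W := P *m _ *m _ => W1.
have WE : W = (P *m L) *m (R *m Q) by rewrite /W !mulmxA.
move: W1; rewrite WE unitmx_mul => /andP[a1 b1].
have -> : invmx (P *m L *m (R *m Q)) = invmx (R *m Q) *m invmx (P *m L).
  have ab1 : P *m L *m (R *m Q) \in unitmx by rewrite unitmx_mul a1.
  apply: (can_inj (mulKmx ab1)).
  by rewrite mulmxV// !mulmxA -(mulmxA (P *m L)) mulmxK// mulmxV.
rewrite -!mulmxA (mulmxA P) (mulmxA (invmx (P *m L))) mulVmx// mul1mx.
by rewrite (mulmxA R) (mulmxA (R *m Q)) mulmxV// mul1mx.
Qed.

(** The image of the differential of the product at [(L, R)], which is the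
    tangent space of the manifold of matrices of rank [k] at [L R]. *)
Definition tangent_model L R : set 'M[K]_(m, n) :=
  [set w.1 *m R + L *m w.2 | w in [set: 'M[K]_(m, k) * 'M[K]_(k, n)]].

(** Linear equations for the tangent space: [1 - L P] annihilates exactly the
    column space of [L] and [1 - Q R], on the right, the row space of [R]. *)
Lemma tangent_modelP L R P Q x : P *m L = 1%:M -> R *m Q = 1%:M ->
  tangent_model L R x <-> (1%:M - L *m P) *m x *m (1%:M - Q *m R) = 0.
Proof.
move=> PL RQ; split=> [[[A B] _ <-] /=|].
  have [[ZL _] [_ RZ]] := (mulmx_retraction_compl PL, mulmx_retraction_compl RQ).
  rewrite (mulmxDr _ (A *m R)) mulmxDl (mulmxA _ L) ZL !mul0mx addr0.
  by rewrite -mulmxA -(mulmxA A) RZ !mulmx0.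
rewrite mulmxBl mul1mx !mulmxBr !mulmx1 mulmxBl => /eqP.
rewrite subr_eq0 => /eqP h.
exists (x *m Q - L *m P *m x *m Q, P *m x) => //=.
by rewrite mulmxBl -!mulmxA; rewrite -!mulmxA in h; rewrite -h subrK.
Qed.

(** Gaussian elimination carries the tangent space at any point to the one at the
    partial identities by an invertible map [M |-> E1 M E2]. *)
Lemma tangent_model_dim : (k <= m)%N -> (k <= n)%N -> exists r, forall L R, D (L, R) ->
  is_subspace_of_dim r (tangent_model L R).
Proof.
move=> km kn.
pose f0 (w : 'M[K]_(m, k) * 'M[K]_(k, n)) : 'M[K]_(m, n) :=
  w.1 *m pid_mx k + pid_mx k *m w.2.
have f0l : linear f0.
  move=> a [A B] [A' B']; rewrite /f0 /= mulmxDl mulmxDr -scalemxAl -scalemxAr.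
  by rewrite addrACA -scalerDr.
pose f0L : {linear _ -> _} := HB.pack f0 (GRing.isLinear.Build _ _ _ _ _ f0l).
have [r hr] := is_subspace_of_dim_range f0L.
exists r => L R [/= Lk Rk].
pose E1 := col_ebase L; pose E2 := row_ebase R.
have E1u : E1 \in unitmx by exact: col_ebase_unit.
have E2u : E2 \in unitmx by exact: row_ebase_unit.
pose e (M : 'M[K]_(m, n)) := E1 *m M *m E2.
have el : linear e.
  by move=> a u v; rewrite /e mulmxDr mulmxDl -scalemxAr -scalemxAl.
pose eL : {linear _ -> _} := HB.pack e (GRing.isLinear.Build _ _ _ _ _ el).
have -> : tangent_model L R = eL @` range f0L.
  rewrite eqEsubset; split => [_ [[A B] _ <-]|_ [_ [[A B] _ <-] <-]] /=.
    exists (f0 (invmx E1 *m A *m col_ebase R, row_ebase L *m B *m invmx E2)).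
      by exists (invmx E1 *m A *m col_ebase R, row_ebase L *m B *m invmx E2).
    rewrite /= /e /f0 /= mulmxDr mulmxDl !mulmxA mulmxV// mul1mx.
    rewrite -[X in _ = _ *m X + _](mulmx_ebase R) -[X in _ = _ + X *m _](mulmx_ebase L).
    by rewrite Lk Rk !mulmxA mulmxKV.
  exists (E1 *m A *m invmx (col_ebase R), invmx (row_ebase L) *m B *m E2) => //=.
  rewrite /e /f0 /= mulmxDr mulmxDl.
  rewrite -[X in _ *m X + _ = _](mulmx_ebase R) -[X in _ + X *m _ = _](mulmx_ebase L).
  rewrite Lk Rk !mulmxA mulmxKV ?col_ebase_unit//.
  by rewrite mulmxK ?row_ebase_unit.
apply: is_subspace_of_dim_image hr.
move=> u v /= /(can_inj (mulmxK E2u)); exact: (can_inj (mulKmx E1u)).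
Qed.

Section Chart.
Variables (L : 'M[K]_(m, k)) (R : 'M[K]_(k, n)) (P : 'M[K]_(k, m)) (Q : 'M[K]_(n, k)).
Hypotheses (PL : P *m L = 1%:M) (RQ : R *m Q = 1%:M).

Let Z := 1%:M - L *m P.
Let Z' := 1%:M - Q *m R.

Definition chart_dom : set 'M[K]_(m, n) := [set g | P *m g *m Q \in unitmx].

(** In block coordinates adapted to [P] and [Q], for which [g] has blocks
    [a], [b], [c], [d] with [a = P g Q], this is the block matrix whose only
    nonzero block is the lower right one, [c a^-1 b].  Subtracting it from [g]
    replaces [d] by the Schur complement. *)
Definition chart_shift g := Z *m g *m Q *m invmx (P *m g *m Q) *m (P *m g *m Z').

Lemma chart_PZ : P *m Z = 0.
Proof. by have [] := mulmx_retraction_compl PL. Qed.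

Lemma chart_ZL : Z *m L = 0.
Proof. by have [] := mulmx_retraction_compl PL. Qed.

Lemma chart_ZQ : Z' *m Q = 0.
Proof. by have [] := mulmx_retraction_compl RQ. Qed.

Lemma chart_RZ : R *m Z' = 0.
Proof. by have [] := mulmx_retraction_compl RQ. Qed.

Lemma chart_ZZ : Z *m Z = Z.
Proof. by rewrite {2}/Z mulmxBr mulmx1 mulmxA chart_ZL mul0mx subr0. Qed.

Lemma chart_ZZ' : Z' *m Z' = Z'.
Proof. by rewrite {1}/Z' mulmxBl mul1mx -mulmxA chart_RZ mulmx0 subr0. Qed.

Lemma open_chart_dom : open chart_dom.
Proof.
apply: open_unitmx => g.
apply: (@cvg_mulmx _ _ (nbhs g) _ _ _ _ (mulmx P) (cst Q)); last exact: cvg_cst.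
by apply: (@cvg_mulmx _ _ (nbhs g) _ _ _ _ (cst P) id); [exact: cvg_cst|exact: cvg_id].
Qed.

Lemma chart_dom_center : chart_dom (L *m R).
Proof. by rewrite /chart_dom /= !mulmxA PL mul1mx RQ unitmx1. Qed.

Lemma Zchart_shift g : Z *m chart_shift g *m Z' = chart_shift g.
Proof.
by rewrite /chart_shift !mulmxA chart_ZZ -(mulmxA _ Z' Z') chart_ZZ'.
Qed.

(** The shift depends only on the blocks that it leaves alone, which is why
    subtracting it and adding it are inverse diffeomorphisms. *)
Lemma chart_shift_inv (a : K) g : chart_shift (g + a *: chart_shift g) = chart_shift g.
Proof.
have PS : P *m chart_shift g = 0 by rewrite -Zchart_shift !mulmxA chart_PZ !mul0mx.
have SQ : chart_shift g *m Q = 0 by rewrite -Zchart_shift -!mulmxA chart_ZQ !mulmx0.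
rewrite {1}/chart_shift !(mulmxDr _ g) -!scalemxAr PS scaler0 addr0.
by rewrite mulmxDl -scalemxAl -[Z *m chart_shift g *m Q]mulmxA SQ mulmx0 scaler0 addr0.
Qed.

Lemma chart_dom_shift (a : K) g : chart_dom (g + a *: chart_shift g) = chart_dom g.
Proof.
have PS : P *m chart_shift g = 0 by rewrite -Zchart_shift !mulmxA chart_PZ !mul0mx.
by rewrite /chart_dom /= mulmxDr -scalemxAr PS scaler0 addr0.
Qed.

Lemma smooth_chart (a : K) : smooth_on chart_dom (fun g => g + a *: chart_shift g).
Proof.
move=> p; have oU := open_chart_dom.
have Cid : Cp_on p chart_dom (fun g : 'M[K]_(m, n) => g).
  by apply: Cp_on_linear => //; move=> x; exact: cvg_id.
have Cc q s (A : 'M[K]_(q, s)) : Cp_on p chart_dom (fun g : 'M[K]_(m, n) => A).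
  exact: Cp_on_cst.
apply: Cp_onD => //.
apply: (Cp_on_ext oU (f := fun g => a%:M *m chart_shift g)).
  by move=> g _; rewrite mul_scalar_mx.
apply: Cp_on_mulmx => //; apply: Cp_on_mulmx => //; last first.
  by apply: Cp_on_mulmx => //; apply: Cp_on_mulmx.
apply: Cp_on_mulmx => //.
  by apply: Cp_on_mulmx => //; apply: Cp_on_mulmx.
by apply: Cp_on_invmx => //; apply: Cp_on_mulmx => //; apply: Cp_on_mulmx.
Qed.

(** The rank is [k] exactly if the Schur complement vanishes. *)
Lemma chart_rankP g : chart_dom g ->
  (G @` D) g <-> Z *m (g - chart_shift g) *m Z' = 0.
Proof.
move=> gU; rewrite (mulmxBr Z g) (mulmxBl (Z *m g)) Zchart_shift; split.
  move=> [[L1 R1] _ /= gE]; rewrite -gE /GM /= in gU *.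
  rewrite {1}(skeleton_decomposition gU) /chart_shift !mulmxA subrr.
  by [].
move=> /eqP; rewrite subr_eq0 => /eqP h.
set W := P *m g *m Q; have W1 : W \in unitmx by exact: gU.
pose E := g - g *m Q *m invmx W *m (P *m g).
have PE : P *m E = 0.
  by rewrite mulmxBr !mulmxA -/W mulmxV// mul1mx subrr.
have EQ : E *m Q = 0.
  by rewrite mulmxBl -!mulmxA (mulmxA P) -/W mulVmx// mulmx1 subrr.
have E0 : E = 0.
  have : Z *m E *m Z' = 0.
    by rewrite (mulmxBr Z g) (mulmxBl (Z *m g)) h /chart_shift -/W !mulmxA subrr.
  by rewrite mulmxBl mul1mx -mulmxA PE mulmx0 subr0 mulmxBr mulmx1 mulmxA EQ mul0mx subr0.
exists (g *m Q, invmx W *m (P *m g)).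
  apply: (@full_rank_unit _ _ P Q); first by rewrite mulmxA.
  by rewrite -mulmxA mulVmx// unitmx1.
by move/eqP: E0; rewrite subr_eq0 => /eqP gE; rewrite /GM /= [RHS]gE !mulmxA.
Qed.

End Chart.

Lemma embedded_rank_manifold : (k <= m)%N -> (k <= n)%N -> embedded_submanifold (G @` D).
Proof.
move=> km kn; have [r hr] := tangent_model_dim km kn.
exists r => _ [[L R] LRD <-]; have /full_rankP[P [Q [PL RQ]]] := LRD.
pose S := chart_shift L R P Q.
have imU : (fun g => g + (-1) *: S g) @` chart_dom P Q = chart_dom P Q.
  rewrite eqEsubset; split => [_ [g gU <-]|g gU].
    by rewrite /S chart_dom_shift.
  exists (g + 1 *: S g); first by rewrite /S chart_dom_shift.
  by rewrite /S chart_shift_inv// scale1r scaleN1r addrK.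
exists (chart_dom P Q), (tangent_model L R), (fun g => g + (-1) *: S g),
  (fun g => g + 1 *: S g); rewrite imU; split; split.
- exact: open_chart_dom.
- exact: chart_dom_center.
- exact: open_chart_dom.
- exact: smooth_chart.
- exact: smooth_chart.
- by move=> g _; rewrite /S chart_shift_inv// scale1r scaleN1r subrK.
- exact: hr.
rewrite eqEsubset; split => [_ [g [gU gX] <-]|g' [+ g'T]].
  split; first by rewrite /S chart_dom_shift.
  by rewrite (tangent_modelP _ PL RQ) scaleN1r; apply/(chart_rankP PL RQ gU).
rewrite -{1}imU => -[g gU gE]; exists g => //; split => //.
apply/(chart_rankP PL RQ gU).
by move: g'T; rewrite -gE (tangent_modelP _ PL RQ) scaleN1r.
Qed.

End RankManifold.

(** * The product equation on the pairs of full rank *)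

Section Admissible.
Context {K : realType} {m n k : nat}.
Local Notation D := (full_rank_pairs K m n k).
Local Notation G := (GM K m n k).
Local Notation V := ('M[K]_(m, k) * 'M[K]_(k, n))%type.
Local Notation W := ('M[K]_(m, n)).
Implicit Types (y w : V) (x u : W).

(** The differential of [G] at [y]. *)
Definition dGM y w : W := w.1 *m y.2 + y.1 *m w.2.

Lemma GM_expansion y w : G (y + w) = G y + dGM y w + G w.
Proof.
by rewrite /GM /dGM /= mulmxDl !mulmxDr -!addrA; congr (_ + _); rewrite addrCA.
Qed.

Lemma dGMZ y (a : K) w : dGM y (a *: w) = a *: dGM y w.
Proof. by rewrite /dGM /= -scalemxAl -scalemxAr scalerDr. Qed.

Lemma GMZ (a : K) w : G (a *: w) = (a * a) *: G w.
Proof. by rewrite /GM /= -scalemxAl -scalemxAr scalerA. Qed.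

Lemma is_derive_inverse_eq x y u w :
  is_derive (x, y) (u, w) (inverse_eq G) (dGM y w - u).
Proof.
apply: (@is_derive_expansion _ _ _ _ _ _ _ (G w)) => h; rewrite /inverse_eq /=.
rewrite (addrC (h *: w)) GM_expansion dGMZ GMZ.
move: (G y) (dGM y w) (G w) => a b c.
by apply/matrixP => i j; rewrite !mxE; ring.
Qed.

Lemma is_derive_inverse_eqr x y w :
  is_derive y w (fun y' => inverse_eq G (x, y')) (dGM y w).
Proof.
apply: (@is_derive_expansion _ _ _ _ _ _ _ (G w)) => h; rewrite /inverse_eq /=.
rewrite (addrC (h *: w)) GM_expansion dGMZ GMZ.
move: (G y) (dGM y w) (G w) => a b c.
by apply/matrixP => i j; rewrite !mxE; ring.
Qed.

Lemma smooth_inverse_eq : smooth_on [set: W * V] (inverse_eq G).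
Proof.
move=> p; have oT := @openT (W * V)%type.
have -> : inverse_eq G = (fun q : W * V => q.2.1 *m q.2.2 + - q.1) by [].
apply: (Cp_onD oT).
  apply: (Cp_on_mulmx oT); apply: (Cp_on_linear oT) => //.
    by move=> q; apply: (cvg_comp snd fst); [exact: cvg_snd|exact: cvg_fst].
  by move=> q; apply: (cvg_comp snd snd); [exact: cvg_snd|exact: cvg_snd].
apply: (Cp_on_mxN oT); apply: (Cp_on_linear oT) => //.
by move=> q; exact: cvg_fst.
Qed.

Lemma smooth_inverse_eqr x : smooth_on [set: V] (fun y => inverse_eq G (x, y)).
Proof.
move=> p; have oT := @openT V.
have -> : (fun y => inverse_eq G (x, y)) = (fun y : V => y.1 *m y.2 + cst (- x) y) by [].
apply: (Cp_onD oT); last exact: Cp_on_cst.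
apply: (Cp_on_mulmx oT); apply: (Cp_on_linear oT) => //.
  by move=> q; exact: cvg_fst.
by move=> q; exact: cvg_snd.
Qed.

Lemma diff_inverse_eq x y u w : 'd (inverse_eq G) (x, y) (u, w) = dGM y w - u.
Proof.
have [_ <-] := is_derive_inverse_eq x y u w; rewrite deriveE//.
by have [+ _] := smooth_inverse_eq 1; apply.
Qed.

Lemma diff_inverse_eqr x y w : 'd (fun y' => inverse_eq G (x, y')) y w = dGM y w.
Proof.
have [_ <-] := is_derive_inverse_eqr x y w; rewrite deriveE//.
by have [+ _] := smooth_inverse_eqr x 1; apply.
Qed.

Lemma tangent_space_open (E : normedModType K) (Y : set E) (y : E) :
  open Y -> Y y -> tangent_space Y y = setT.
Proof.
move=> oY Yy; rewrite eqEsubset; split => // v _.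
exists (fun t : K => y + t *: v); split.
- by rewrite scale0r addr0.
- have : y + t *: v @[t --> (0 : K)] --> y + (0 : K) *: v.
    by apply: cvgD; [exact: cvg_cst|apply: cvgZr_tmp; exact: cvg_id].
  by rewrite scale0r addr0; apply; exact: open_nbhs_nbhs.
- exact: is_derive_line.
Qed.

Lemma tangent_space_cst (E : normedModType K) (X : set E) (x : E) :
  X x -> tangent_space X x 0.
Proof.
move=> Xx; exists (cst x); split; [by []|by near=> t|exact: is_derive_cst].
Unshelve. all: by end_near. Qed.

(** Let [g] be a curve of matrices of rank [k] and [q] its difference quotient.
    By the skeleton decomposition [Z g Z'] is a product containing both [Z g Q]
    and [P g Z'].  Both vanish at time 0, so [Z q Z'] tends to 0. *)
Lemma tangent_space_GM y v : D y -> tangent_space (G @` D) (G y) v ->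
  tangent_model y.1 y.2 v.
Proof.
case: y => L R LRD [g [g0 gX [dg gv]]].
have /full_rankP[P [Q [PL RQ]]] := LRD.
apply/(tangent_modelP _ PL RQ).
set Z := 1%:M - L *m P; set Z' := 1%:M - Q *m R.
have [[ZL _] [_ RZ]] := (mulmx_retraction_compl PL, mulmx_retraction_compl RQ).
pose q h := h^-1 *: (g (h *: (1 : K) + 0) - g 0).
have qv : q h @[h --> 0^'] --> v by rewrite -gv; exact: dg.
have gc : g h @[h --> (0 : K)^'] --> L *m R.
  have : g h @[h --> (0 : K)] --> g 0.
    by apply: differentiable_continuous; apply/derivable1_diffP.
  by rewrite g0; apply: cvg_trans; apply: cvg_app; exact: cvg_within.
have gWc : P *m g h *m Q @[h --> (0 : K)^'] --> (1%:M : 'M[K]_k).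
  have : P *m g h *m Q @[h --> (0 : K)^'] --> P *m (L *m R) *m Q.
    apply: (cvg_mulmx (f := fun h => P *m g h) (g := cst Q)); last exact: cvg_cst.
    by apply: (cvg_mulmx (f := cst P) (g := g)) => //; exact: cvg_cst.
  by rewrite !mulmxA PL mul1mx RQ.
have iWc : invmx (P *m g h *m Q) @[h --> (0 : K)^'] --> (1%:M : 'M[K]_k).
  rewrite -[X in _ --> X]invmx1.
  apply: (cvg_comp (fun h => P *m g h *m Q) (@invmx _ k) gWc).
  exact: (invmx_continuous (unitmx1 _ _)).
have lim1 : Z *m q h *m Z' @[h --> (0 : K)^'] --> Z *m v *m Z'.
  apply: (cvg_mulmx (f := fun h => Z *m q h) (g := cst Z')); last exact: cvg_cst.
  by apply: (cvg_mulmx (f := cst Z) (g := q)) => //; exact: cvg_cst.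
have lim2 : Z *m q h *m Q @[h --> (0 : K)^'] --> Z *m v *m Q.
  apply: (cvg_mulmx (f := fun h => Z *m q h) (g := cst Q)); last exact: cvg_cst.
  by apply: (cvg_mulmx (f := cst Z) (g := q)) => //; exact: cvg_cst.
have lim3 : P *m (g h - L *m R) *m Z' @[h --> (0 : K)^'] --> P *m 0 *m Z'.
  apply: (cvg_mulmx (f := fun h => P *m (g h - L *m R)) (g := cst Z'));
    last exact: cvg_cst.
  apply: (cvg_mulmx (f := cst P) (g := fun h => g h - L *m R)); first exact: cvg_cst.
  by rewrite -[X in _ --> X](subrr (L *m R)); apply: cvgB => //; exact: cvg_cst.
have lim4 := cvg_mulmx (cvg_mulmx lim2 iWc) lim3.
have E : \forall h \near (0 : K)^', Z *m q h *m Q *m invmx (P *m g h *m Q) *m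
    (P *m (g h - L *m R) *m Z') = Z *m q h *m Z'.
  near=> h.
  have : (G @` D) (g h).
    by near: h; exact: (nbhs_dnbhs gX).
  have : P *m g h *m Q \in unitmx.
    near: h; apply: (gWc [set M : 'M[K]_k | M \in unitmx]); apply: open_nbhs_nbhs; split.
      by apply: open_unitmx => x; exact: cvg_id.
    by rewrite /= unitmx1.
  move=> ghU [[L1 R1] _ gE].
  have Zg1 : Z *m (g h - L *m R) = Z *m g h.
    by rewrite (mulmxBr Z (g h)) (mulmxA Z) ZL mul0mx subr0.
  have Zg2 : (g h - L *m R) *m Z' = g h *m Z'.
    by rewrite (mulmxBl (g h)) -(mulmxA L) RZ mulmx0 subr0.
  rewrite -(mulmxA P (g h - L *m R)) Zg2 /q -[h *: 1]/(h * 1) mulr1 addr0 g0.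
  rewrite -!scalemxAr -!scalemxAl; congr (_ *: _).
  rewrite Zg1; rewrite -gE /GM /= in ghU *; rewrite [in RHS](skeleton_decomposition ghU).
  by rewrite !mulmxA.
have lim5 := cvg_trans (near_eq_cvg E) (lim4 _ _).
rewrite (cvg_unique (@norm_hausdorff _ _) lim1 (lim5 _ _ _)).
by rewrite !mulmx0 mul0mx mulmx0.
Unshelve. all: by end_near. Qed.

Lemma embedded_open_pairs (Y : set V) : open Y -> embedded_submanifold Y.
Proof.
move=> oY; exists (m * k + k * n)%N => y Yy.
exists Y, setT, id, id; rewrite image_id; split; split => //.
- by move=> p; apply: (Cp_on_linear oY) => // x; exact: cvg_id.
- by move=> p; apply: (Cp_on_linear oY) => // x; exact: cvg_id.
- exact: is_subspace_of_dim_setT_pair.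
- by rewrite image_id setIid setIT.
Qed.

(** At a solution the differential of the equation is [DG w - u] with [u]
    tangent to the image, hence in the range of [DG]. *)
Lemma fcre_GM : (k <= m)%N -> (k <= n)%N -> fcre (G @` D) D (inverse_eq G) 0.
Proof.
move=> km kn; split.
- exact: embedded_rank_manifold.
- exact/embedded_open_pairs/open_full_rank_pairs.
- by exists setT; split; [exact: openT|exact: subsetT|exact: smooth_inverse_eq].
- by move=> _ [y Dy <-]; exists y => //; rewrite /inverse_eq /= subrr.
have [r hr] := tangent_model_dim (K := K) km kn.
exists r => x y Xx Dy; have oD := @open_full_rank_pairs K m n k.
rewrite (tangent_space_open oD Dy); split=> [|/eqP].
  have -> : [set 'd (fun y' => inverse_eq G (x, y')) y w | w in setT] =
      tangent_model y.1 y.2.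
    by rewrite eqEsubset; split => _ [w _ <-]; exists w => //; rewrite diff_inverse_eqr.
  by apply: hr; rewrite -surjective_pairing.
rewrite /inverse_eq /= subr_eq0 => /eqP xE; rewrite -xE in Xx *.
have -> : [set 'd (inverse_eq G) (G y, y) w |
    w in tangent_space (G @` D) (G y) `*` setT] = tangent_model y.1 y.2.
  rewrite eqEsubset; split => [_ [[u w] [/= /(tangent_space_GM Dy)[u' _ <-] _] <-]|].
    rewrite diff_inverse_eq; exists (w - u') => //.
    rewrite /dGM /= mulmxBl mulmxBr opprD addrACA.
    by [].
  move=> _ [w _ <-]; exists (0, w); first by split => //=; exact: tangent_space_cst.
  by rewrite diff_inverse_eq subr0.
by apply: hr; rewrite -surjective_pairing.
Qed.

Lemma admissible_full_rank_pairs y : (k <= m)%N -> (k <= n)%N -> D y ->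
  admissible_nbhd D G y D.
Proof.
move=> km kn Dy; split => //; [exact: open_full_rank_pairs| |exact: fcre_GM].
exact: embedded_rank_manifold.
Qed.

End Admissible.

(** * Fibres of the product map *)

Section Factorisation.
Context {K : realType} {m n k : nat}.
Local Notation D := (full_rank_pairs K m n k).
Local Notation G := (GM K m n k).
Local Notation V := ('M[K]_(m, k) * 'M[K]_(k, n))%type.
Local Notation W := ('M[K]_(m, n)).
Local Notation ipV := (@inner_product_mxdot2 K m k k n).
Local Notation ipW := (@inner_product_mxdot K m n).
Local Notation "`| x |_V" := (@enorm K V mxdot2 x) (at level 0, x at level 99).
Local Notation "`| x |_F" := (enorm mxdot x) (at level 0, x at level 99).
Implicit Types (y w : V) (x u : W).

(** The adjoint of the infinitesimal action [C |-> (L C, - C R)] of GL_k on the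
    fibre: it vanishes on the displacements orthogonal to the fibre at [y]. *)
Definition imbalance y w : 'M[K]_k := y.1^T *m w.1 - w.2 *m y.2^T.

Lemma dGM_imbalance y w :
  mxdot (dGM y w) (dGM y w) + mxdot (imbalance y w) (imbalance y w) =
  (mxdot (y.1^T *m w.1) (y.1^T *m w.1) + mxdot (w.1 *m y.2) (w.1 *m y.2)) +
  (mxdot (y.1 *m w.2) (y.1 *m w.2) + mxdot (w.2 *m y.2^T) (w.2 *m y.2^T)).
Proof.
have ipk := inner_product_mxdot (R := K) k k.
rewrite /dGM /imbalance !(dotDl ipW, dotDr ipW) !(dotBl ipk, dotBr ipk).
rewrite (mxdotC (y.1 *m w.2) (w.1 *m y.2)) (mxdotC (w.2 *m y.2^T) (y.1^T *m w.1)).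
have -> : mxdot (w.1 *m y.2) (y.1 *m w.2) = mxdot (y.1^T *m w.1) (w.2 *m y.2^T).
  by rewrite mxdot_mulr -mulmxA mxdotC mxdot_mull mxdotC.
ring.
Qed.

Lemma enorm_GM_le w : `|G w|_F <= `|w|_V ^+ 2.
Proof.
rewrite (sqr_enorm ipV) /mxdot2 (le_trans (enorm_mulmx _ _))//.
have -> : mxdot w.1 w.1 = `|w.1|_F ^+ 2 by rewrite (sqr_enorm (inner_product_mxdot _ _)).
have -> : mxdot w.2 w.2 = `|w.2|_F ^+ 2 by rewrite (sqr_enorm (inner_product_mxdot _ _)).
have := enorm_ge0 (dot := mxdot) w.1; have := enorm_ge0 (dot := mxdot) w.2.
move: (enorm _ _) (enorm _ _) => a b a0 b0.
by have := sqr_ge0 (a - b); nra.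
Qed.

(** A nonzero [f 0] would make [s * f s] change sign at 0. *)
Lemma root_of_zero_quotient (f : K -> K) : {for 0, continuous f} ->
  (\forall s \near (0 : K), 0 <= s * f s) -> f 0 = 0.
Proof.
move=> cf sf; apply/eqP/negPn/negP => f0.
have fpos : \forall s \near (0 : K), 0 < f s * f 0.
  have : f s * f 0 @[s --> (0 : K)] --> f 0 * f 0.
    by apply: cvgM; [exact: cf|exact: cvg_cst].
  by move=> /cvgr_gt; apply; rewrite -expr2 exprn_even_gt0.
have c : - (t * f 0) @[t --> (0 : K)^'+] --> (0 : K).
  have : - (t * f 0) @[t --> (0 : K)] --> - (0 * f 0).
    by apply: cvgN; apply: cvgM; [exact: cvg_id|exact: cvg_cst].
  by rewrite mul0r oppr0 => /cvg_at_right_filter.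
have : \forall t \near (0 : K)^'+, False.
  near=> t.
  have t0 : 0 < t by near: t; exact: nbhs_right_gt.
  have h1 : 0 <= - (t * f 0) * f (- (t * f 0)) by near: t; exact: (c _ sf).
  have h2 : 0 < f (- (t * f 0)) * f 0 by near: t; exact: (c _ fpos).
  have : 0 < t * (f (- (t * f 0)) * f 0) by rewrite mulr_gt0.
  have -> : t * (f (- (t * f 0)) * f 0) = - (- (t * f 0) * f (- (t * f 0))) by ring.
  by rewrite oppr_gt0 ltNge h1.
by move=> /filter_ex[].
Unshelve. all: by end_near. Qed.

(** First-order condition.  Along [(L (1 + s E), (1 + s E)^-1 R)] with [E] an
    elementary matrix the inverse is explicit, and the first variation of the
    squared distance is twice an entry of the imbalance. *)
Lemma balanced_of_local_min y0 y :
  (\forall y' \near y, G y' = G y -> `|y - y0|_V <= `|y' - y0|_V) ->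
  imbalance y (y - y0) = 0.
Proof.
move=> ymin; case: y y0 ymin => [L R] [L0 R0] ymin.
rewrite /imbalance /=; apply/matrixP => a b; rewrite [RHS]mxE [LHS]mxE [X in _ + X]mxE.
set A := L - L0; set B := R - R0.
pose E : 'M[K]_k := delta_mx a b; pose d : K := (a == b)%:R.
have EE : E *m E = d *: E.
  by rewrite /E /d mul_delta_mx_cond eq_sym; case: eqP => _; rewrite ?scale1r ?scale0r.
(* As E E = d E, the inverse of 1 + s E is 1 - s c(s) E. *)
pose c (s : K) := (1 + s * d)^-1.
have c0 : c 0 = 1 by rewrite /c mul0r addr0 invr1.
have c1 : 1 + s * d @[s --> (0 : K)] --> (1 : K) + 0 * d.
  by apply: cvgD; [exact: cvg_cst|apply: cvgM; [exact: cvg_id|exact: cvg_cst]].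
have cc : {for 0, continuous c}.
  have h : (1 : K) + 0 * d != 0 by rewrite mul0r addr0 oner_neq0.
  have := @cvgV K K (nbhs (0 : K)) _ (fun s => 1 + s * d) _ h c1; exact.
have nz : \forall s \near (0 : K), 1 + s * d != 0.
  move: c1; rewrite mul0r addr0 => /cvgr_gt /(_ _ ltr01); apply: filterS => s.
  by move=> /lt0r_neq0.
pose ys (s : K) : V := (L + s *: (L *m E), R - (s * c s) *: (E *m R)).
have ysc : ys s @[s --> (0 : K)] --> (L, R).
  have -> : (L, R) = ys 0 by rewrite /ys scale0r mul0r scale0r addr0 subr0.
  have h1 : L + s *: (L *m E) @[s --> (0 : K)] --> L + (0 : K) *: (L *m E).
    by apply: cvgD; [exact: cvg_cst|apply: cvgZr_tmp; exact: cvg_id].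
  have h2 : R - (s * c s) *: (E *m R) @[s --> (0 : K)] --> R - (0 * c 0) *: (E *m R).
    apply: cvgB; first exact: cvg_cst.
    by apply: cvgZr_tmp; apply: cvgM; [exact: cvg_id|exact: cc].
  exact: (cvg_pair h1 h2).
have Gys : \forall s \near (0 : K), G (ys s) = G (L, R).
  apply: filterS nz => s s0; rewrite /GM /ys /=.
  rewrite mulmxDl !mulmxBr -!scalemxAl -!scalemxAr !mulmxA -(mulmxA L E E) EE.
  rewrite -scalemxAr -scalemxAl !scalerA; move: (L *m E *m R) (L *m R) => M X.
  apply/matrixP => i j; rewrite !mxE /c; field.
  by rewrite s0.
pose a1 := mxdot (L *m E) (L *m E); pose b1 := mxdot (E *m R) (E *m R).
pose p := mxdot A (L *m E); pose q := mxdot B (E *m R).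
have pE : p = (L^T *m A) a b.
  rewrite /p mxdotC mxdot_mull mxdotE (bigD1 a)//= (bigD1 b)//= !big1 ?addr0.
  - by rewrite [X in X * _]mxE !eqxx mul1r.
  - move=> i /negPf ia; rewrite big1// => j _.
    by rewrite [X in X * _]mxE ia mul0r.
  - by move=> j /negPf jb; rewrite [X in X * _]mxE jb andbF mul0r.
have qE : q = (B *m R^T) a b.
  rewrite /q mxdotC mxdot_mulr mxdotE (bigD1 a)//= (bigD1 b)//= !big1 ?addr0.
  - by rewrite [X in X * _]mxE !eqxx mul1r.
  - move=> i /negPf ia; rewrite big1// => j _.
    by rewrite [X in X * _]mxE ia mul0r.
  - by move=> j /negPf jb; rewrite [X in X * _]mxE jb andbF mul0r.
rewrite -pE -qE.
(* The increase of the squared distance along the path is s * f s. *)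
pose f (s : K) := 2 * p + s * a1 - 2 * c s * q + s * c s ^+ 2 * b1.
have f0 : f 0 = 0.
  apply: root_of_zero_quotient.
    apply: cvgD; last first.
      apply: cvgM; last exact: cvg_cst.
      by apply: cvgM; [exact: cvg_id|apply: cvgM; exact: cc].
    apply: cvgB.
      by apply: cvgD; [exact: cvg_cst|apply: cvgM; [exact: cvg_id|exact: cvg_cst]].
    apply: cvgM; last exact: cvg_cst.
    by apply: cvgM; [exact: cvg_cst|exact: cc].
  have := ysc _ ymin; rewrite /nbhs /=; apply: filterS2 Gys => s Gs /(_ Gs).
  have ip1 := inner_product_mxdot (R := K) m k.
  have ip2 := inner_product_mxdot (R := K) k n.
  rewrite /enorm ler_sqrt ?(dot_ge0 ipV)// /mxdot2 /ys /=.
  rewrite (addrAC L) (addrAC R) -/A -/B; clearbody A B.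
  rewrite !(dotDl ip1, dotDr ip1, dotZl ip1, dotZr ip1).
  rewrite !(dotBl ip2, dotBr ip2, dotZl ip2, dotZr ip2).
  rewrite (mxdotC (L *m E) A) (mxdotC (E *m R) B) -/a1 -/b1 -/p -/q.
  rewrite -subr_ge0; congr (0 <= _); rewrite /f; ring.
have : 2 * (p - q) = 0 by rewrite -f0 /f c0; ring.
by move/eqP; rewrite mulf_eq0 pnatr_eq0 /= => /eqP.
Qed.

(** The skeleton decomposition [x = (x Q) ((P x Q)^-1 P x)] is a continuous
    section of [G] near [G y0]. *)
Lemma GM_local_section y0 e : D y0 -> 0 < e ->
  \forall x \near G y0, (exists y, G y = x) -> exists y, G y = x /\ `|y - y0|_V < e.
Proof.
case: y0 => L R /full_rankP[P [Q [PL RQ]]] e0.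
pose W0 x := P *m x *m Q.
have W0c : W0 x @[x --> G (L, R)] --> (1%:M : 'M[K]_k).
  have : W0 x @[x --> G (L, R)] --> W0 (G (L, R)).
    apply: (cvg_mulmx (F := nbhs (G (L, R))) (f := mulmx P) (g := cst Q));
        last exact: cvg_cst.
    by apply: (cvg_mulmx (F := nbhs (G (L, R))) (f := cst P) (g := id));
        [exact: cvg_cst|exact: cvg_id].
  by rewrite /W0 /GM /= !mulmxA PL mul1mx RQ.
have iWc : invmx (W0 x) @[x --> G (L, R)] --> (1%:M : 'M[K]_k).
  rewrite -[X in _ --> X]invmx1.
  apply: (cvg_comp W0 (@invmx _ k) W0c).
  exact: (invmx_continuous (unitmx1 _ _)).
pose s x : V := (x *m Q, invmx (W0 x) *m (P *m x)).
have sc : s x @[x --> G (L, R)] --> (L, R).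
  have s1 : x *m Q @[x --> G (L, R)] --> G (L, R) *m Q.
    by apply: (cvg_mulmx (F := nbhs (G (L, R))) (f := id) (g := cst Q));
        [exact: cvg_id|exact: cvg_cst].
  have s2 : P *m x @[x --> G (L, R)] --> P *m G (L, R).
    by apply: (cvg_mulmx (F := nbhs (G (L, R))) (f := cst P) (g := id));
        [exact: cvg_cst|exact: cvg_id].
  have := cvg_pair s1 (cvg_mulmx iWc s2).
  rewrite /GM /= mul1mx -mulmxA RQ mulmx1 mulmxA PL mul1mx => h; exact: h.
have uW : \forall x \near G (L, R), W0 x \in unitmx.
  apply: (W0c [set M : 'M[K]_k | M \in unitmx]); apply: open_nbhs_nbhs; split.
    by apply: open_unitmx => x; exact: cvg_id.
  by rewrite /= unitmx1.
have se : \forall x \near G (L, R), `|s x - (L, R)|_V < e.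
  exact: (sc _ (nbhs_enorm_lt ipV _ e0)).
near=> x => -[[L1 R1] xE].
exists (s x); split; last by near: x.
have : W0 x \in unitmx by near: x.
rewrite -xE /s /GM /W0 /= => h.
by rewrite [RHS](skeleton_decomposition h) !mulmxA.
Unshelve. all: by end_near. Qed.

End Factorisation.

(** * The condition number *)

Section LatentConditionNumber.
Context {K : realType} {m n k : nat}.
Hypotheses (k_gt0 : (0 < k)%N) (km : (k <= m)%N) (kn : (k <= n)%N).
Local Notation D := (full_rank_pairs K m n k).
Local Notation G := (GM K m n k).
Local Notation V := ('M[K]_(m, k) * 'M[K]_(k, n))%type.
Local Notation W := ('M[K]_(m, n)).
Local Notation ipV := (@inner_product_mxdot2 K m k k n).
Local Notation ipW := (@inner_product_mxdot K m n).
Local Notation "`| x |_V" := (@enorm K V mxdot2 x) (at level 0, x at level 99).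
Local Notation "`| x |_F" := (enorm mxdot x) (at level 0, x at level 99).
Implicit Types (y w z : V) (x u : W).

(** At pairs of full rank, the smallest nonzero eigenvalue of [DG DG^*], which
    acts on matrices by [M |-> M R^T R + L L^T M]. *)
Definition singular_gap y : K :=
  Num.min (sigma k y.1 ^+ 2 + sigma n y.2 ^+ 2) (sigma m y.1 ^+ 2 + sigma k y.2 ^+ 2).

Lemma m_gt0 : (0 < m)%N. Proof. exact: leq_trans km. Qed.
Lemma n_gt0 : (0 < n)%N. Proof. exact: leq_trans kn. Qed.

Lemma singular_gap_gt0 y : D y -> 0 < singular_gap y.
Proof.
case: y => L R /full_rankP[P [Q [PL RQ]]].
have sL := sigma_gt0_free k_gt0 PL.
have sR := sigma_gt0_full k_gt0 RQ.
by rewrite /singular_gap lt_min /= ltr_wpDr ?sqr_ge0 ?exprn_gt0//=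
  ltr_wpDl ?sqr_ge0 ?exprn_gt0.
Qed.

Lemma singular_gap_le y w : singular_gap y * mxdot2 w w <=
  mxdot (dGM y w) (dGM y w) + mxdot (imbalance y w) (imbalance y w).
Proof.
rewrite dGM_imbalance /mxdot2 mulrDr.
have h1 : sigma m y.1 ^+ 2 * mxdot w.1 w.1 <= mxdot (y.1^T *m w.1) (y.1^T *m w.1).
  rewrite -(mxdot_trmx w.1) -(mxdot_trmx (_ *m _)) trmx_mul trmxK.
  exact: sigma_trmx_lower_bound m_gt0.
have h2 := sigma_trmx_lower_bound y.2 w.1 k_gt0.
have h3 := sigma_lower_bound y.1 w.2 k_gt0.
have h4 : sigma n y.2 ^+ 2 * mxdot w.2 w.2 <= mxdot (w.2 *m y.2^T) (w.2 *m y.2^T).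
  rewrite -(mxdot_trmx w.2) -(mxdot_trmx (w.2 *m _)) trmx_mul trmxK.
  exact: sigma_lower_bound n_gt0.
apply: lerD.
  apply: le_trans (lerD h1 h2); rewrite -mulrDl ler_wpM2r ?mxdot_ge0//.
  by rewrite ge_min lexx orbT.
apply: le_trans (lerD h3 h4); rewrite -mulrDl ler_wpM2r ?mxdot_ge0//.
by rewrite ge_min lexx.
Qed.

(** [M |-> M R^T R + L L^T M] is diagonalised by the products [u v^T] of left
    singular vectors of [L] and right singular vectors of [R]. *)
Lemma exists_gap_vector y : exists2 M : W, `|M|_F = 1 &
  M *m y.2^T *m y.2 + y.1 *m (y.1^T *m M) = singular_gap y *: M.
Proof.
have key i j : (0 < i <= m)%N -> (0 < j <= n)%N -> exists2 M : W, `|M|_F = 1 &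
    M *m y.2^T *m y.2 + y.1 *m (y.1^T *m M) =
    (sigma i y.1 ^+ 2 + sigma j y.2 ^+ 2) *: M.
  move=> im jn; have [u u1 uE] := exists_sigma_vector_trmx y.1 im.
  have [v v1 vE] := exists_sigma_vector y.2 jn.
  exists (u *m v^T).
    by rewrite /enorm mxdot_mull mulmxA trmx_mul_cV u1 mul1mx mxdot_trmx v1 sqrtr1.
  rewrite scalerDl addrC !mulmxA uE -scalemxAl; congr (_ + _).
  rewrite -!mulmxA scalemxAr; congr (_ *m _); apply: trmx_inj.
  by rewrite linearZ /= trmxK -vE !trmx_mul !trmxK.
have km' : (0 < k <= m)%N by rewrite k_gt0.
have kn' : (0 < k <= n)%N by rewrite k_gt0.
rewrite /singular_gap; case: leP => _; apply: key => //.
  by rewrite n_gt0 /=.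
by rewrite m_gt0 /=.
Qed.

Section AtPoint.
Variables (y0 : V) (Y : set V).
Hypotheses (Dy0 : D y0) (oY : open Y) (Yy0 : Y y0) (YD : Y `<=` D).

Let s := Num.sqrt (singular_gap y0).
Let X := G @` Y.
Let distY := geodist (@mxdot2 K m k k n) Y.
Let distX := geodist (@mxdot K m n) X.
Let sols := nearest_solutions mxdot2 Y (inverse_eq G) 0 y0.
Let H := nearest_solution mxdot2 Y (inverse_eq G) 0 y0.

Lemma gap_root_gt0 : 0 < s.
Proof. by rewrite sqrtr_gt0 singular_gap_gt0. Qed.

Lemma sqr_gap_root : s ^+ 2 = singular_gap y0.
Proof. by rewrite sqr_sqrtr// ltW// singular_gap_gt0. Qed.

(** The imbalance at [y0 + w] vanishes, so that at [y0] it equals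
    [B B^T - A^T A] for [w = (A, B)]; this and the quadratic term [G w] of [G]
    are both at most [|w|^2]. *)
Lemma balanced_lower_bound w : imbalance (y0 + w) w = 0 ->
  s * `|w|_V <= `|G (y0 + w) - G y0|_F + 2 * `|w|_V ^+ 2.
Proof.
move=> yw.
have GE : G (y0 + w) - G y0 = dGM y0 w + G w.
  by rewrite GM_expansion addrC !addrA addNr add0r.
have Nw : `|imbalance y0 w|_F <= `|w|_V ^+ 2.
  have -> : imbalance y0 w = w.2 *m w.2^T - w.1^T *m w.1.
    apply/eqP; rewrite -subr_eq0 -yw /imbalance /= !linearD /=.
    rewrite mulmxDl; apply/eqP.
    move: (y0.1^T *m w.1) (w.2 *m y0.2^T) (w.1^T *m w.1) (w.2 *m w.2^T) => a b c d.
    by apply/matrixP => i j; rewrite !mxE; ring.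
  apply: le_trans (enormB (inner_product_mxdot _ _) _ _) _.
  have e1 : `|w.1^T|_F = `|w.1|_F by rewrite /enorm mxdot_trmx.
  have e2 : `|w.2^T|_F = `|w.2|_F by rewrite /enorm mxdot_trmx.
  apply: le_trans (lerD (enorm_mulmx _ _) (enorm_mulmx _ _)) _.
  rewrite e1 e2 -!expr2 !(sqr_enorm (inner_product_mxdot _ _)) (sqr_enorm ipV).
  by rewrite /mxdot2 addrC.
have Gw := enorm_GM_le w.
have dw : `|dGM y0 w|_F <= `|G (y0 + w) - G y0|_F + `|w|_V ^+ 2.
  have -> : dGM y0 w = (G (y0 + w) - G y0) - G w by rewrite GE addrK.
  by apply: le_trans (enormB ipW _ _) _; rewrite lerD2l.
have := singular_gap_le y0 w.
rewrite -sqr_gap_root -(sqr_enorm ipV) -(sqr_enorm ipW).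
rewrite -(sqr_enorm (inner_product_mxdot _ _) (imbalance y0 w)) -exprMn.
have := enorm_ge0 (dot := mxdot) (dGM y0 w).
have := enorm_ge0 (dot := mxdot) (imbalance y0 w).
have := enorm_ge0 (dot := mxdot) (G (y0 + w) - G y0).
have := enorm_ge0 (dot := @mxdot2 K m k k n) w.
move: Nw dw.
move: `|dGM y0 w|_F `|imbalance y0 w|_F `|G (y0 + w) - G y0|_F `|w|_V => d N e a.
move=> Na da a0 e0 N0 d0 h.
rewrite -(@ler_pXn2r _ 2) ?nnegrE//; last 2 first.
- by rewrite mulr_ge0// ltW// gap_root_gt0.
- by rewrite addr_ge0// mulr_ge0// sqr_ge0.
apply: le_trans h _.
have h1 : d ^+ 2 <= (e + a ^+ 2) ^+ 2 by rewrite ler_pXn2r// nnegrE (le_trans d0).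
have h2 : N ^+ 2 <= (a ^+ 2) ^+ 2 by rewrite ler_pXn2r// nnegrE (le_trans N0).
apply: le_trans (lerD h1 h2) _.
have := mulr_ge0 e0 (sqr_ge0 a); have := sqr_ge0 (a ^+ 2).
by move: (a ^+ 2) => a2; nra.
Qed.

(** A solution in a ball inside [Y] keeps all nearest solutions in that ball,
    where geodesic and Euclidean distances from the centre agree. *)
Lemma enorm_nearest_solution x y z e :
  (forall z, `|z - y0|_V < e -> Y z) -> Y y -> G y = x -> `|y - y0|_V < e ->
  sols x z ->
  [/\ `|z - y0|_V <= `|y - y0|_V, distY y0 z = `|z - y0|_V%:E & imbalance z (z - y0) = 0].
Proof.
move=> eY Yy Gy ye [Yz Gz zmin].
have solP y' : inverse_eq G (x, y') = 0 <-> G y' = x.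
  by rewrite /inverse_eq /=; split=> [/eqP|->]; rewrite ?subrr// subr_eq0 => /eqP.
have zy : `|z - y0|_V <= `|y - y0|_V.
  rewrite -lee_fin -(geodist_ball ipV eY ye).
  apply: le_trans (enorm_sub_le_geodist ipV Y y0 z) _.
  by apply: zmin => //; exact/solP.
have ze : `|z - y0|_V < e by apply: le_lt_trans ye.
split => //; first exact: (geodist_ball ipV eY ze).
apply: balanced_of_local_min.
have : `|z' - y0|_V @[z' --> z] --> `|z - y0|_V.
  by apply: (cvg_enorm ipV); apply: cvgB; [exact: cvg_id|exact: cvg_cst].
move=> /cvgr_lt /(_ _ ze); apply: filterS => z' ze' Gz'.
rewrite -lee_fin -(geodist_ball ipV eY ze) -(geodist_ball ipV eY ze').
by apply: zmin; [exact: eY|rewrite (solP z') Gz'; exact/solP].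
Qed.

Lemma nearest_solution_center : H (G y0) = y0.
Proof.
rewrite /H /nearest_solution; case: xgetP => // z _ zs.
have [e e0 eY] := enorm_nbhs ipV (open_nbhs_nbhs (conj oY Yy0)).
have y0e : `|y0 - y0|_V < e by rewrite subrr (enorm0 ipV).
have [+ _ _] := enorm_nearest_solution eY Yy0 erefl y0e zs.
rewrite subrr (enorm0 ipV) => z0; apply/eqP; rewrite -subr_eq0; apply/eqP.
by apply: (enorm_eq0 ipV); apply/eqP; rewrite eq_le z0 enorm_ge0.
Qed.

(** The local section provides a solution close to [y0], which confines the
    nearest solutions.  Where there is none, the value is the default [y0] and
    the bound holds with [a = 0]. *)
Lemma nearest_solution_bound e : 0 < e ->
  \forall x \near G y0, X x -> exists a, [/\ 0 <= a, a < e, distY y0 (H x) = a%:E &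
     s * a <= `|x - G y0|_F + 2 * a ^+ 2].
Proof.
move=> e0; have [r r0 rY] := enorm_nbhs ipV (open_nbhs_nbhs (conj oY Yy0)).
have er0 : 0 < Num.min e r by rewrite lt_min e0.
have := GM_local_section Dy0 er0; apply: filterS => x hx [y' Yy' Gy'].
have [y [Gy ye]] := hx (ex_intro _ y' Gy').
have [yltr ylte] : `|y - y0|_V < r /\ `|y - y0|_V < e.
  by move: ye; rewrite lt_min => /andP[].
exists `|H x - y0|_V; rewrite /H /nearest_solution; case: xgetP => [z _ zs|_].
  have [zy dz zi] := enorm_nearest_solution rY (rY _ yltr) Gy yltr zs.
  split; [exact: enorm_ge0|exact: le_lt_trans ylte|exact: dz|].
  have [_ + _] := zs; rewrite /inverse_eq /= => /eqP; rewrite subr_eq0 => /eqP <-.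
  by have := balanced_lower_bound (w := z - y0); rewrite addrC subrK; apply.
have z0 : `|y0 - y0|_V = 0 by rewrite subrr (enorm0 ipV).
rewrite z0; split => //.
- by rewrite /distY (geodist_ball ipV rY) z0.
- by rewrite mulr0 expr0n mulr0 addr0 enorm_ge0.
Qed.

(** Solutions at least as close as [y] form a compact set, and the other ones
    are farther away than [y]. *)
Lemma exists_nearest_solution e y : (forall z, `|z - y0|_V < e -> Y z) ->
  `|y - y0|_V < e -> sols (G y) (H (G y)).
Proof.
move=> eY ye; suff [z zs] : exists z, sols (G y) z.
  by exact: (xgetPex y0 (ex_intro _ z zs)).
pose S := [set z : V | G z = G y /\ `|z - y0|_V <= `|y - y0|_V].
have nc : continuous (fun z : V => `|z - y0|_V).
  by move=> z; apply: (cvg_enorm ipV); apply: cvgB; [exact: cvg_id|exact: cvg_cst].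
have Gc : continuous G.
  move=> z; apply: (cvg_mulmx (F := nbhs z) (f := fst) (g := snd));
    [exact: cvg_fst|exact: cvg_snd].
have cS : compact S.
  apply: (@compact_mx_pair _ _ _ _ _ _ (Num.norm y0 + `|y - y0|_V)).
    move=> z [_ zy]; rewrite -{1}(subrK y0 z) addrC.
    by apply: le_trans (ler_normD _ _) _; rewrite lerD2l (le_trans (norm_le_enorm ipV _)).
  have -> : S = G @^-1` [set G y] `&`
      (fun z : V => `|z - y0|_V) @^-1` [set t | t <= `|y - y0|_V] by [].
  apply: closedI; apply: closed_comp.
  - by move=> z _; exact: Gc.
  - exact: (accessible_closed_set1 (hausdorff_accessible (@norm_hausdorff _ _))).
  - by move=> z _; exact: nc.
  - exact: closed_le.
have S0 : S !=set0 by exists y; split.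
have [z /set_mem[Gz zy] zmin] := compact_EVT_min S0 cS (continuous_subspaceT nc).
have ze := le_lt_trans zy ye.
exists z; split; [exact: eY|by rewrite /inverse_eq /= Gz subrr|].
move=> z' Yz' Gz'; rewrite (geodist_ball ipV eY ze).
apply: le_trans (enorm_sub_le_geodist ipV _ _ _); rewrite lee_fin.
have [z'y|/ltW yz'] := leP `|z' - y0|_V `|y - y0|_V; last exact: le_trans yz'.
apply: zmin; apply/mem_set; split => //.
by move: Gz' => /eqP; rewrite /inverse_eq /= subr_eq0 => /eqP.
Qed.

Lemma exists_extremal_direction : exists (M : W) w,
  [/\ `|M|_F = 1, `|w|_V = s, dGM y0 w = singular_gap y0 *: M &
      forall w', mxdot M (dGM y0 w') = mxdot2 w w'].
Proof.
have [M M1 ME] := exists_gap_vector y0.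
pose w : V := (M *m y0.2^T, y0.1^T *m M).
have dw : dGM y0 w = singular_gap y0 *: M by [].
have adj w' : mxdot M (dGM y0 w') = mxdot2 w w'.
  rewrite /dGM /mxdot2 (dotDr ipW) /w /=; congr (_ + _).
    by rewrite mxdotC mxdot_mulr mxdotC.
  by rewrite mxdotC mxdot_mull mxdotC.
exists M, w; split => //.
by rewrite /enorm -adj dw (dotZr ipW) -(sqr_enorm ipW) M1 expr1n mulr1.
Qed.

Section Direction.
Variables (M : W) (w : V).
Hypotheses (M1 : `|M|_F = 1) (ws : `|w|_V = s) (dw : dGM y0 w = singular_gap y0 *: M).
Hypothesis Mw : forall w', mxdot M (dGM y0 w') = mxdot2 w w'.

Lemma enorm_GM_direction : `|G w|_F <= s ^+ 2.
Proof. by rewrite -ws; exact: enorm_GM_le. Qed.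

Lemma GM_direction t : G (y0 + t *: w) = G y0 + (t * s ^+ 2) *: M + (t * t) *: G w.
Proof. by rewrite GM_expansion dGMZ GMZ dw sqr_gap_root scalerA. Qed.

Lemma dot_GM_direction_ge t : 0 < t ->
  t * s ^+ 2 - t ^+ 2 * s ^+ 2 <= mxdot M (G (y0 + t *: w) - G y0).
Proof.
move=> t0; have -> : G (y0 + t *: w) - G y0 = (t * s ^+ 2) *: M + (t * t) *: G w.
  by rewrite GM_direction addrC !addrA addNr add0r.
rewrite (dotDr ipW) !(dotZr ipW).
rewrite -(sqr_enorm ipW) M1 expr1n mulr1 lerD2l -expr2 lerNl -(mulrN (t ^+ 2)).
rewrite ler_pM2l ?exprn_gt0// -(dotNr ipW) (le_trans (dot_le_enorm ipW _ _))//.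
by rewrite M1 mul1r (enormN ipW) enorm_GM_direction.
Qed.

(** Pair [G z - G y0] with [M]: the linear part of the increment is
    [<w, z - y0> <= s |z - y0|]. *)
Lemma fibre_distance_ge t z : 0 < t -> G z = G (y0 + t *: w) ->
  `|z - y0|_V <= t * s -> t * s - 2 * t ^+ 2 * s <= `|z - y0|_V.
Proof.
move=> t0 Gz zt; have s0 := gap_root_gt0.
have a0 := enorm_ge0 (dot := @mxdot2 K m k k n) (z - y0).
have := dot_GM_direction_ge t0; rewrite -Gz.
have -> : G z - G y0 = dGM y0 (z - y0) + G (z - y0).
  have {1}-> : z = y0 + (z - y0) by rewrite addrC subrK.
  by rewrite GM_expansion addrC !addrA addNr add0r.
rewrite (dotDr ipW) Mw => h.
have h1 := dot_le_enorm ipV w (z - y0); have h2 := dot_le_enorm ipW M (G (z - y0)).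
have h3 := enorm_GM_le (z - y0).
rewrite ws in h1; rewrite M1 mul1r in h2.
have h4 : `|z - y0|_V ^+ 2 <= (t * s) ^+ 2.
  by rewrite ler_pXn2r// nnegrE// mulr_ge0// ltW.
rewrite -(ler_pM2l s0); move: h h1 h2 h3 h4; rewrite exprMn.
by move: `|z - y0|_V => a; nra.
Qed.

(** The length of the curve [r |-> G (y0 + (1 - r) t w)]. *)
Lemma distX_direction_le e t : 0 < t -> (forall z, `|z - y0|_V < e -> Y z) -> t * s < e ->
  (distX (G (y0 + t *: w)%R) (G y0) <= (t * s ^+ 2 + 2 * t ^+ 2 * s ^+ 2)%:E)%E.
Proof.
move=> t0 eY te; have s0 := gap_root_gt0.
pose dg (r : K) : W := - (t * s ^+ 2) *: M - (2 * (1 - r) * t ^+ 2) *: G w.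
apply: (geodist_le ipW (g := fun r : K => G (y0 + ((1 - r) * t) *: w)) (dg := dg)).
- move=> r; apply: (@is_derive_expansion _ _ _ _ _ _ _ ((t ^+ 2) *: G w)) => h.
  rewrite !GM_direction /dg -[h *: 1]/(h * 1).
  move: (G y0) (G w) => a c.
  by apply/matrixP => i j; rewrite !mxE; ring.
- move=> r; apply: cvgB; first exact: cvg_cst.
  apply: cvgZr_tmp; apply: cvgM; last exact: cvg_cst.
  by apply: cvgM; [exact: cvg_cst|apply: cvgB; [exact: cvg_cst|exact: cvg_id]].
- move=> r; rewrite in_itv /= => /andP[r0 r1]; exists (y0 + ((1 - r) * t) *: w) => //.
  apply: eY; rewrite addrAC subrr add0r (enormZ ipV) ws.
  rewrite ger0_norm ?mulr_ge0 ?subr_ge0 ?(ltW t0)// -mulrA.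
  apply: le_lt_trans te; rewrite ler_piMl ?mulr_ge0 ?(ltW t0) ?(ltW s0)//.
  by rewrite gerBl.
- by rewrite subr0 mul1r.
- by rewrite subrr mul0r scale0r addr0.
move=> r; rewrite in_itv /= => /andP[r0 r1].
apply: le_trans (enormB ipW _ _) _; rewrite !(enormZ ipW) M1 mulr1 normrN.
have h1 : 0 <= t * s ^+ 2 by rewrite mulr_ge0 ?sqr_ge0// ltW.
have h2 : 0 <= 2 * (1 - r) * t ^+ 2.
  by rewrite mulr_ge0 ?sqr_ge0// mulr_ge0// subr_ge0.
rewrite (ger0_norm h1) (ger0_norm h2) lerD2l {h1 h2}.
have := enorm_GM_direction; have := enorm_ge0 (dot := mxdot) (G w); have := sqr_ge0 t.
have := sqr_ge0 s.
move: `|G w|_F (t ^+ 2) (s ^+ 2) => a t2 s2 s20 t20 a0 as2.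
apply: (@le_trans _ _ (2 * t2 * a)); last by rewrite ler_wpM2l// mulr_ge0.
rewrite ler_wpM2r// ler_wpM2r// ler_piMr//.
by rewrite gerBl.
Qed.

End Direction.

Let ratio x := (distY (H (G y0)) (H x) / distX x (G y0))%E.

Let kappa := latent_cond mxdot mxdot2 X Y (inverse_eq G) 0 (G y0) y0.

Lemma latent_condE : kappa =
  limf_esup ratio (within X (G y0)^').
Proof. by []. Qed.

Lemma latent_cond_le : (kappa <= (s^-1)%R%:E)%E.
Proof.
rewrite latent_condE limf_esupE; apply/lee_addgt0Pr => eps eps0.
have s0 := gap_root_gt0.
(* For displacements a < r the bound s a <= d + 2 a^2 becomes
   (s - 2 r) a <= d. *)
have [r [r0 rs rE]] : exists r, [/\ 0 < r, 0 < s - 2 * r & (s - 2 * r)^-1 <= s^-1 + eps].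
  have : (s - 2 * r)^-1 @[r --> (0 : K)^'+] --> s^-1.
    have : (s - 2 * r)^-1 @[r --> (0 : K)] --> (s - 2 * 0)^-1.
      apply: cvgV; first by rewrite mulr0 subr0 gt_eqF.
      by apply: cvgB; [exact: cvg_cst|apply: cvgM; [exact: cvg_cst|exact: cvg_id]].
    by rewrite mulr0 subr0 => /cvg_at_right_filter.
  move=> /cvgr_le /(_ (s^-1 + eps)); rewrite ltrDl => /(_ eps0) h.
  have : \forall r \near (0 : K)^'+,
      [/\ 0 < r, 0 < s - 2 * r & (s - 2 * r)^-1 <= s^-1 + eps].
    near=> r; split.
    - by near: r; exact: nbhs_right_gt.
    - have : r < s / 2 by near: r; apply: nbhs_right_lt; rewrite divr_gt0.
      by rewrite ltr_pdivlMr// mulrC subr_gt0.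
    - by near: r; exact: h.
  exact: filter_ex.
pose A := [set x | (ratio x <= (s^-1 + eps)%R%:E)%E].
apply: (@le_trans _ _ (ereal_sup (ratio @` A))).
  apply: ereal_inf_lbound; exists A => //.
  have := nearest_solution_bound r0; rewrite /within /= /dnbhs /within /=.
  apply: filterS => x hx xx0 Xx; rewrite /A /=.
  have [a [a0 ar da sa]] := hx Xx.
  rewrite /ratio nearest_solution_center da.
  have d0 : 0 < `|x - G y0|_F.
    rewrite lt0r enorm_ge0 andbT; apply/eqP => /(enorm_eq0 ipW)/eqP.
    by rewrite subr_eq0 (negPf xx0).
  have dX : ((`|x - G y0|_F)%R%:E <= distX x (G y0))%E.
    by rewrite (enormBC ipW); exact: (enorm_sub_le_geodist ipW X x (G y0)).
  have ad : a <= (s - 2 * r)^-1 * `|x - G y0|_F.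
    rewrite mulrC ler_pdivlMr//.
    have : 2 * a ^+ 2 <= 2 * r * a by rewrite expr2 -mulrA ler_wpM2l// ler_wpM2r// ltW.
    by move: sa; move: `|x - G y0|_F => d; lra.
  move: dX; case: (distX x (G y0)) => [r'||] //; last first.
    move=> _; rewrite invey mule0 lee_fin; apply: addr_ge0; last exact: ltW.
    by rewrite invr_ge0 ltW.
  rewrite lee_fin => dX; have r'0 : 0 < r' by exact: lt_le_trans dX.
  rewrite inver gt_eqF// -EFinM lee_fin ler_pdivrMr//.
  apply: le_trans ad _; apply: (@le_trans _ _ ((s - 2 * r)^-1 * r')).
    by rewrite ler_wpM2l// invr_ge0 ltW.
  by rewrite ler_wpM2r// ltW.
by apply: ge_ereal_sup => _ [x Ax <-].
Unshelve. all: by end_near. Qed.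

Lemma latent_cond_ge : ((s^-1)%R%:E <= kappa)%E.
Proof.
rewrite latent_condE limf_esupE; apply: le_ereal_inf_tmp => _ [A FA <-].
have s0 := gap_root_gt0.
have [M [w [M1 ws dw Mw]]] := exists_extremal_direction.
have [e e0 eY] := enorm_nbhs ipV (open_nbhs_nbhs (conj oY Yy0)).
apply/lee_subgt0Pr => eps eps0.
have xc : G (y0 + t *: w) @[t --> (0 : K)^'+] --> G y0.
  have : G (y0 + t *: w) @[t --> (0 : K)] --> G (y0 + (0 : K) *: w).
    have yc : y0 + t *: w @[t --> (0 : K)] --> y0 + (0 : K) *: w.
      by apply: cvgD; [exact: cvg_cst|apply: cvgZr_tmp; exact: cvg_id].
    apply: (cvg_mulmx (F := nbhs (0 : K))
             (f := fun t => (y0 + t *: w).1) (g := fun t => (y0 + t *: w).2)).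
      by apply: (cvg_comp _ fst yc); exact: cvg_fst.
    by apply: (cvg_comp _ snd yc); exact: cvg_snd.
  by rewrite scale0r addr0 => /cvg_at_right_filter.
(* The lower bound t s - 2 t^2 s for the distance of solutions, divided by the
   upper bound t s^2 + 2 t^2 s^2 for the distance of data. *)
have lim : (1 - 2 * t) / (s * (1 + 2 * t)) @[t --> (0 : K)^'+] --> s^-1.
  have : (1 - 2 * t) / (s * (1 + 2 * t)) @[t --> (0 : K)] -->
      (1 - 2 * 0) / (s * (1 + 2 * 0)).
    have c2 : 2 * t @[t --> (0 : K)] --> (2 * 0 : K).
      by apply: cvgM; [exact: cvg_cst|exact: cvg_id].
    apply: cvgM; first by apply: cvgB => //; exact: cvg_cst.
    apply: cvgV; first by rewrite mulr0 addr0 mulr1 gt_eqF.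
    apply: cvgM; first exact: cvg_cst.
    by apply: cvgD => //; exact: cvg_cst.
  by rewrite mulr0 subr0 addr0 mulr1 mul1r => /cvg_at_right_filter.
have : \forall t \near (0 : K)^'+, [/\ 0 < t, t < 1 / 2, t * s < e,
    (G (y0 + t *: w) != G y0 -> X (G (y0 + t *: w)) -> A (G (y0 + t *: w))) &
    s^-1 - eps <= (1 - 2 * t) / (s * (1 + 2 * t))].
  near=> t; split.
  - by near: t; exact: nbhs_right_gt.
  - by near: t; apply: nbhs_right_lt; rewrite divr_gt0.
  - rewrite -ltr_pdivlMr//; near: t; apply: nbhs_right_lt; rewrite divr_gt0//.
  - by near: t; exact: (xc _ FA).
  - by near: t; move/cvgr_ge: lim; apply; rewrite ltrBlDr ltrDl.
move=> /filter_ex[t [t0 t1 te tA tl]].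
set x := G (y0 + t *: w) in tA.
have wt : `|(y0 + t *: w) - y0|_V = t * s.
  by rewrite addrAC subrr add0r (enormZ ipV) ws gtr0_norm.
have Xx : X x by exists (y0 + t *: w) => //; apply: eY; rewrite wt.
have d0 : 0 < `|x - G y0|_F.
  rewrite -[X in _ < X]mul1r -M1; apply: lt_le_trans (dot_le_enorm ipW _ _).
  apply: lt_le_trans (dot_GM_direction_ge M1 ws dw t0).
  rewrite -mulrBl mulr_gt0 ?exprn_gt0// subr_gt0 expr2 gtr_pMl//.
  by apply: lt_le_trans t1 _; lra.
have xx0 : x != G y0.
  by apply/eqP => xE; move: d0; rewrite xE subrr (enorm0 ipW) ltxx.
have yte : `|(y0 + t *: w) - y0|_V < e by rewrite wt.
have Hx := exists_nearest_solution eY yte.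
have [zt dz _] := enorm_nearest_solution eY (eY _ yte) erefl yte Hx.
have Gz : G (H x) = x.
  by have [_ + _] := Hx; rewrite /inverse_eq /= => /eqP; rewrite subr_eq0 => /eqP.
rewrite wt in zt.
have az := fibre_distance_ge M1 ws dw Mw t0 Gz zt.
have dX := distX_direction_le M1 ws dw t0 eY te.
have dX' : ((`|x - G y0|_F)%R%:E <= distX x (G y0))%E.
  by rewrite (enormBC ipW); exact: (enorm_sub_le_geodist ipW X x (G y0)).
apply: (@le_trans _ _ (ratio x)); last first.
  by apply: ereal_sup_ubound; exists x => //; exact: tA.
rewrite /ratio nearest_solution_center dz -EFinB.
move: dX dX'; rewrite -/x; case: (distX x (G y0)) => [r||] //; rewrite !lee_fin => rt dr.
have r0 : 0 < r by exact: lt_le_trans dr.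
rewrite inver gt_eqF// -EFinM lee_fin; apply: le_trans tl _.
rewrite ler_pdivlMr//; apply: le_trans az.
have q0 : 0 < s * (1 + 2 * t) by rewrite mulr_gt0// ltr_wpDr// mulr_ge0// ltW.
rewrite mulrAC ler_pdivrMr//.
apply: (@le_trans _ _ ((1 - 2 * t) * (t * s ^+ 2 + 2 * t ^+ 2 * s ^+ 2))).
  by rewrite ler_wpM2l// subr_ge0; lra.
by rewrite le_eqVlt; apply/orP; left; apply/eqP; ring.
Unshelve. all: by end_near. Qed.

Lemma latent_cond_GM :
  latent_cond mxdot mxdot2 X Y (inverse_eq G) 0 (G y0) y0 = (s^-1)%:E.
Proof. by apply/eqP; rewrite eq_le latent_cond_le latent_cond_ge. Qed.

End AtPoint.

(** The two bounds hold in every open neighbourhood inside the domain, hence the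
    value is the same for all admissible ones. *)
Lemma inv_latent_cond_GM y : D y ->
  inv_latent_cond mxdot2 mxdot D G y = (1 / Num.sqrt (singular_gap y))%:E.
Proof.
move=> Dy; rewrite /inv_latent_cond; set S := [set kappa | _].
have lc Y : admissible_nbhd D G y Y -> latent_cond mxdot mxdot2 (G @` Y) Y
    (inverse_eq G) 0 (G y) y = (1 / Num.sqrt (singular_gap y))%:E.
  by move=> [oY Yy YD _ _]; rewrite div1r; exact: latent_cond_GM.
have adm := admissible_full_rank_pairs km kn Dy.
have : S (xget -oo%E S).
  apply: (@xgetPex _ -oo%E S); exists (1 / Num.sqrt (singular_gap y))%:E.
  by split => //; exists D.
by move=> [_ /(_ _ adm) <-]; exact: lc.
Qed.

End LatentConditionNumber.

Theorem proposition5p2 (K : realType) (m n k : nat)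
    (k_gt0 : (0 < k)%N) (k_le : (k <= minn m n)%N)
    (L : 'M[K]_(m, k)) (R : 'M[K]_(k, n))
    (LR_dom : full_rank_pairs K m n k (L, R)) :
  inv_latent_cond mxdot2 mxdot (full_rank_pairs K m n k) (GM K m n k) (L, R)
    = (1 / Num.sqrt (Num.min (sigma k L ^+ 2 + sigma n R ^+ 2)
                             (sigma m L ^+ 2 + sigma k R ^+ 2)))%:E /\
  ((k < minn m n)%N ->
   inv_latent_cond mxdot2 mxdot (full_rank_pairs K m n k) (GM K m n k) (L, R)
     = (Num.min (sigma k L) (sigma k R))^-1%:E).
Proof.
have [km kn] : (k <= m)%N /\ (k <= n)%N by move: k_le; rewrite leq_min => /andP[].
have E := inv_latent_cond_GM k_gt0 km kn LR_dom.
split=> [|klt]; rewrite E //.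
have [km' kn'] : (k < m)%N /\ (k < n)%N by move: klt; rewrite leq_min => /andP[].
rewrite /singular_gap /= (sigma_eq0 L (i := m)); last by rewrite (minn_idPr km).
rewrite (sigma_eq0 R (i := n)); last by rewrite (minn_idPl kn).
rewrite expr0n /= addr0 add0r div1r; congr (_^-1%:E).
have := sigma_ge0 L k; have := sigma_ge0 R k.
move: (sigma k L) (sigma k R) => a b b0 a0.
have [ab|/ltW ba] := leP a b.
  by rewrite min_l ?ler_pXn2r// sqrtr_sqr ger0_norm.
by rewrite min_r ?ler_pXn2r// sqrtr_sqr ger0_norm.
Qed.
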